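(* Let $(\varphi_1(z_1,z_2,t),\ \varphi_2(z_1,z_2,t),\ a(t)z_3)$ be a solution of the three-dimensional homogeneous incompressible Euler equations in Lagrangian coordinates, with $a(t)\neq0$ for all $t$. Let $c_0\in\mathbb{R}$ be a constant, and consider $$\varphi=\big(\varphi_1(z_1,z_2,t),\ \varphi_2(z_1,z_2,t),\ f(z_1,z_2,t)+a(t)z_3\big),\qquad \rho=c_0z_3.$$ Then $f$ has no effect on $\det(d\varphi)$ and $h^3$, while $$(h^1)'=a\,\frac{\partial f''}{\partial z_2}-a''\frac{\partial f}{\partial z_2}-c_0\frac{\partial f}{\partial z_2},\qquad -(h^2)'=a\,\frac{\partial f''}{\partial z_1}-a''\frac{\partial f}{\partial z_1}-c_0\frac{\partial f}{\partial z_1}.$$ Both $(h^1)'$ and $(h^2)'$ vanish, so that $(\varphi,\rho)$ is a solution to the Euler--Boussinesq equations, if and only if $$af''-(a''+c_0)f=0.$$ The general solution of this equation is $$f=a_1(t)f^1(z_1,z_2)+a_2(t)f^2(z_1,z_2),$$ where $a_1,a_2$ are two linearly independent solutions of $$y''+qy=0,\qquad q=-\frac{a''+c_0}{a},$$ and $f^1,f^2$ are arbitrary functions of $(z_1,z_2)$ (there is no condition on them other than that they do not depend on $z_3$). Thus the solution set is parametrized by $a$ via $q$.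
   Context: Primes denote time derivatives; $z=(z_1,z_2,z_3)$ are Lagrangian coordinates in a domain $D\subset\mathbb{R}^3$, and $\nabla$, $d\varphi$ denote the gradient and Jacobian matrix with respect to $z$. All functions are as differentiable as the formulas require. For a map $\varphi(z,t)\in\mathbb{R}^3$ and a function $\rho$ on $D$, put $$h=(h^1,h^2,h^3)=\sum_{i=1}^3\nabla\varphi_i'\times\nabla\varphi_i+\nabla\rho\times\nabla\int\varphi_3\,dt,$$ so that $h'=\sum_{i=1}^3\nabla\varphi_i''\times\nabla\varphi_i+\nabla\rho\times\nabla\varphi_3$. The pair $(\varphi,\rho)$ is a solution to the three-dimensional Euler--Boussinesq equations (in Lagrangian form, $\rho$ being a rescaled density variable absorbing the gravitational constant) if and only if $\det(d\varphi)\neq0$ everywhere and $\det(d\varphi)$, $\rho$ and $h$ are independent of time. A map is a solution of the homogeneous incompressible Euler equations in Lagrangian coordinates if its Jacobian determinant is nonzero everywhere and independent of time and $\sum_{i=1}^3\nabla\varphi_i'\times\nabla\varphi_i$ is independent of time.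
   Formalization: f does affect h^3: its contribution (∂1f')(∂2f)−(∂2f')(∂1f) is stated and shown time-independent once (h^1)'=(h^2)'=0; these vanish iff af''−(a''+c_0)f=0 holds after subtracting some b(t) from f (literally iff when the equation holds at one point). *)

(* Defs.v *)
From Stdlib Require Import Reals.
From Coquelicot Require Import Coquelicot.
Open Scope R_scope.

Definition vec : Type := (R * R * R)%type.

Definition crd1 (v : vec) : R := fst (fst v).
Definition crd2 (v : vec) : R := snd (fst v).
Definition crd3 (v : vec) : R := snd v.

Definition cross (u v : vec) : vec :=
  (crd2 u * crd3 v - crd3 u * crd2 v,
   crd3 u * crd1 v - crd1 u * crd3 v,
   crd1 u * crd2 v - crd2 u * crd1 v).

Definition det3 (u v w : vec) : R :=
  crd1 u * (crd2 v * crd3 w - crd3 v * crd2 w)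
  - crd2 u * (crd1 v * crd3 w - crd3 v * crd1 w)
  + crd3 u * (crd1 v * crd2 w - crd2 v * crd1 w).

(* Scalar functions u(z,t) and vector-valued maps phi(z,t).  They are total
   functions; only their values on D x T (both open) are ever used. *)
Definition sfield : Type := vec -> R -> R.
Definition vfield : Type := vec -> R -> vec.

Definition comp1 (phi : vfield) : sfield := fun z t => crd1 (phi z t).
Definition comp2 (phi : vfield) : sfield := fun z t => crd2 (phi z t).
Definition comp3 (phi : vfield) : sfield := fun z t => crd3 (phi z t).

Definition dt (u : sfield) : sfield := fun z t => Derive (u z) t.
Definition pd1 (u : sfield) : sfield :=
  fun z t => Derive (fun x => u (x, crd2 z, crd3 z) t) (crd1 z).
Definition pd2 (u : sfield) : sfield :=
  fun z t => Derive (fun x => u (crd1 z, x, crd3 z) t) (crd2 z).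
Definition pd3 (u : sfield) : sfield :=
  fun z t => Derive (fun x => u (crd1 z, crd2 z, x) t) (crd3 z).

Definition grad (u : sfield) : vfield := fun z t => (pd1 u z t, pd2 u z t, pd3 u z t).

Definition jacdet (phi : vfield) : sfield :=
  fun z t => det3 (grad (comp1 phi) z t) (grad (comp2 phi) z t) (grad (comp3 phi) z t).

Definition connected_set (D : vec -> Prop) : Prop :=
  forall U V : vec -> Prop, open U -> open V ->
    (forall z, D z -> U z \/ V z) ->
    (exists z, D z /\ U z) -> (exists z, D z /\ V z) ->
    exists z, D z /\ U z /\ V z.

Definition is_domain (D : vec -> Prop) : Prop :=
  open D /\ connected_set D /\ exists z, D z.

Definition is_open_interval (T : R -> Prop) : Prop :=
  open T /\ (forall r s t, T r -> T t -> r <= s <= t -> T s) /\ exists t, T t.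

Definition cont_on (D : vec -> Prop) (T : R -> Prop) (u : sfield) : Prop :=
  forall z t, D z -> T t ->
    continuous (fun p : vec * R => u (fst p) (snd p)) (z, t).

(* u has a spatial gradient, and u and its gradient are jointly continuous. *)
Definition C1_space (D : vec -> Prop) (T : R -> Prop) (u : sfield) : Prop :=
  (forall z t, D z -> T t ->
     ex_derive (fun x => u (x, crd2 z, crd3 z) t) (crd1 z) /\
     ex_derive (fun x => u (crd1 z, x, crd3 z) t) (crd2 z) /\
     ex_derive (fun x => u (crd1 z, crd2 z, x) t) (crd3 z)) /\
  cont_on D T u /\ cont_on D T (pd1 u) /\ cont_on D T (pd2 u) /\ cont_on D T (pd3 u).

Definition ex_dt (D : vec -> Prop) (T : R -> Prop) (u : sfield) : Prop :=
  forall z t, D z -> T t -> ex_derive (u z) t.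

(* u, u', u'' and their spatial gradients exist and are jointly continuous:
   exactly the derivatives that occur in h' and in the equations below.
   Continuity makes time and space derivatives commute. *)
Definition C1_space_C2_time (D : vec -> Prop) (T : R -> Prop) (u : sfield) : Prop :=
  C1_space D T u /\
  ex_dt D T u /\ C1_space D T (dt u) /\
  ex_dt D T (dt u) /\ C1_space D T (dt (dt u)).

Definition C2_on (T : R -> Prop) (y : R -> R) : Prop :=
  forall t, T t ->
    ex_derive y t /\ ex_derive (Derive y) t /\ continuous (Derive (Derive y)) t.

Definition regular_map (D : vec -> Prop) (T : R -> Prop) (phi : vfield) : Prop :=
  C1_space_C2_time D T (comp1 phi) /\
  C1_space_C2_time D T (comp2 phi) /\
  C1_space_C2_time D T (comp3 phi).

Definition time_indep {A : Type} (D : vec -> Prop) (T : R -> Prop)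
    (u : vec -> R -> A) : Prop :=
  forall z s t, D z -> T s -> T t -> u z s = u z t.

(* sum_i grad phi_i' x grad phi_i *)
Definition vort (phi : vfield) : vfield := fun z t =>
  plus (plus (cross (grad (dt (comp1 phi)) z t) (grad (comp1 phi) z t))
             (cross (grad (dt (comp2 phi)) z t) (grad (comp2 phi) z t)))
       (cross (grad (dt (comp3 phi)) z t) (grad (comp3 phi) z t)).

(* The indefinite time integral of phi_3 is taken from a base time t0.  When
   rho is independent of time, another t0 changes hvec by a time-independent
   amount only. *)
Definition hvec (t0 : R) (phi : vfield) (rho : sfield) : vfield := fun z t =>
  plus (vort phi z t)
       (cross (grad rho z t)
              (grad (fun z t => RInt (comp3 phi z) t0 t) z t)).

Definition euler_solution (D : vec -> Prop) (T : R -> Prop) (phi : vfield) : Prop :=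
  regular_map D T phi /\
  (forall z t, D z -> T t -> jacdet phi z t <> 0) /\
  time_indep D T (jacdet phi) /\
  time_indep D T (vort phi).

Definition euler_boussinesq_solution (D : vec -> Prop) (T : R -> Prop) (t0 : R)
    (phi : vfield) (rho : sfield) : Prop :=
  regular_map D T phi /\ C1_space D T rho /\
  (forall z t, D z -> T t -> jacdet phi z t <> 0) /\
  time_indep D T (jacdet phi) /\
  time_indep D T rho /\
  time_indep D T (hvec t0 phi rho).

(* A function of (z1,z2,t), resp. (z1,z2), seen as a function of (z,t). *)
Definition lift (g : R -> R -> R -> R) : sfield := fun z t => g (crd1 z) (crd2 z) t.
Definition lift_static (g : R -> R -> R) : sfield := fun z _ => g (crd1 z) (crd2 z).

Definition base_map (phi1 phi2 : R -> R -> R -> R) (a : R -> R) : vfield :=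
  fun z t => (phi1 (crd1 z) (crd2 z) t, phi2 (crd1 z) (crd2 z) t, a t * crd3 z).

Definition pert_map (phi1 phi2 f : R -> R -> R -> R) (a : R -> R) : vfield :=
  fun z t => (phi1 (crd1 z) (crd2 z) t, phi2 (crd1 z) (crd2 z) t,
              f (crd1 z) (crd2 z) t + a t * crd3 z).

Definition lin_density (c0 : R) : sfield := fun z _ => c0 * crd3 z.

(* a f'' - (a'' + c0) f *)
Definition residual (a : R -> R) (c0 : R) (f : R -> R -> R -> R) : sfield :=
  fun z t => a t * dt (dt (lift f)) z t - (Derive (Derive a) t + c0) * lift f z t.

Definition f_equation (D : vec -> Prop) (T : R -> Prop) (a : R -> R) (c0 : R)
    (f : R -> R -> R -> R) : Prop :=
  forall z t, D z -> T t -> residual a c0 f z t = 0.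

Definition h12_constant (D : vec -> Prop) (T : R -> Prop) (h : vfield) : Prop :=
  forall z t, D z -> T t ->
    is_derive (comp1 h z) t 0 /\ is_derive (comp2 h z) t 0.

Definition qfun (a : R -> R) (c0 : R) : R -> R :=
  fun t => - ((Derive (Derive a) t + c0) / a t).

Definition ode_solution (T : R -> Prop) (q y : R -> R) : Prop :=
  forall t, T t ->
    ex_derive y t /\ ex_derive (Derive y) t /\ Derive (Derive y) t + q t * y t = 0.

Definition lin_indep (T : R -> Prop) (y1 y2 : R -> R) : Prop :=
  forall k1 k2 : R, (forall t, T t -> k1 * y1 t + k2 * y2 t = 0) -> k1 = 0 /\ k2 = 0.

(* Main.v *)
Require Import Defs.
From Stdlib Require Import Reals Lra Lia.
From Coquelicot Require Import Coquelicot.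
Open Scope R_scope.

(** Adding [f(z1,z2,t)] to the third component of a map that stretches [z3] by
    [a(t)] leaves the third column of the Jacobian matrix equal to [(0,0,a)], so
    the determinant does not see [f] ([jacdet_pert]).  In the same way the
    horizontal components of the vorticity-like field [h] receive contributions
    from the third component and from the density only, and for [i] in [{1,2}]
    they are, up to order and sign,

      [a * d_i f' - a' * d_i f - c0 * (integral of d_i f)].

    Differentiating in time, with the space and time derivatives interchanged
    ([pd_dt_commute], [pd_RInt]), the terms [a' * d_i f'] cancel and what is left
    is [d_i (a f'' - (a'' + c0) f)], the horizontal gradient of the residual.
    Since the residual does not depend on [z3] and the domain is connected, the
    gradient vanishes iff the residual is a function of time alone
    ([h12_constant_iff_residual]); this function is removed by subtracting
    [b(t) = f(p,t)] for any base point [p].  When the gradient vanishes, the two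
    products in the contribution [d_1 f' d_2 f - d_2 f' d_1 f] to [h^3] have the
    same time derivative ([gradient_wronskian_time_indep]): this contribution is
    a Wronskian of two solutions of one linear equation.  Hence
    [h] is constant in time as soon as its first two components are.

    For fixed [z] the equation on [f] is [y'' + q y = 0].  Picard iteration gives
    solutions on the whole time interval ([ode_initial_value]), and constancy of
    the Wronskian gives everything else: any solution is expressed through two
    given ones by Cramer's rule ([ode_expansion]), with coefficients that are
    Wronskians at one fixed time, so that they inherit the regularity in [z] of
    the solution and of its time derivative ([general_solution]). *)

(** * Calculus on an open interval *)

Lemma interval_between (T : R -> Prop) (r t s : R) :
  is_open_interval T -> T r -> T t -> Rmin r t <= s <= Rmax r t -> T s.
Proof.
  intros [_ [HT _]] Hr Ht Hs.
  destruct (Rle_dec r t) as [H|H].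
  - rewrite Rmin_left, Rmax_right in Hs by lra. now apply (HT r s t).
  - rewrite Rmin_right, Rmax_left in Hs by lra. now apply (HT t s r).
Qed.

Lemma interval_locally (T : R -> Prop) (t : R) :
  is_open_interval T -> T t -> locally t T.
Proof. intros [HT _] Ht. now apply HT. Qed.

Lemma is_derive_value (g : R -> R) (t l l' : R) :
  is_derive g t l -> l = l' -> is_derive g t l'.
Proof. now intros H <-. Qed.

Lemma constant_of_zero_derivative (T : R -> Prop) (g : R -> R) :
  is_open_interval T -> (forall t, T t -> is_derive g t 0) ->
  forall s t, T s -> T t -> g s = g t.
Proof.
  intros HT Hg.
  assert (Hlt : forall s t, T s -> T t -> s < t -> g s = g t).
  { intros s t Hs Ht Hst. apply (eq_is_derive g); [|exact Hst].
    intros r Hr. apply Hg. destruct HT as [_ [HT _]]. now apply (HT s r t). }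
  intros s t Hs Ht. destruct (Rtotal_order s t) as [H|[H|H]].
  - now apply Hlt.
  - now subst.
  - symmetry. now apply Hlt.
Qed.

Lemma ex_RInt_interval (T : R -> Prop) (g : R -> R) (r t : R) :
  is_open_interval T -> (forall s, T s -> continuous g s) ->
  T r -> T t -> ex_RInt g r t.
Proof.
  intros HT Hg Hr Ht. apply (ex_RInt_continuous (V := R_CompleteNormedModule)).
  intros s Hs. apply Hg. now apply (interval_between T r t).
Qed.

Lemma is_derive_RInt_interval (T : R -> Prop) (g : R -> R) (r t : R) :
  is_open_interval T -> (forall s, T s -> continuous g s) ->
  T r -> T t -> is_derive (fun s => RInt g r s) t (g t).
Proof.
  intros HT Hg Hr Ht.
  apply (is_derive_RInt g (fun s => RInt g r s) r); [|now apply Hg].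
  apply (filter_imp T); [|now apply interval_locally].
  intros s Hs. apply (RInt_correct (V := R_CompleteNormedModule)).
  now apply (ex_RInt_interval T).
Qed.

Lemma continuous_pair {U V W : UniformSpace} (g : U -> V) (k : U -> W) (x : U) :
  continuous g x -> continuous k x -> continuous (fun y => (g y, k y)) x.
Proof.
  intros Hg Hk. apply (continuous_comp_2 g k pair x Hg Hk).
  apply (continuous_ext (fun p => p)); [now intros []|apply continuous_id].
Qed.

Lemma continuous_snd_only (u : R -> R -> R) (x t : R) :
  continuous (fun p : R * R => u (fst p) (snd p)) (x, t) -> continuous (u x) t.
Proof.
  intros H. apply (continuous_comp_2 (fun _ : R => x) (fun s : R => s) u t);
    [apply continuous_const|apply continuous_id|exact H].
Qed.

Lemma is_derive_under_RInt (T : R -> Prop) (u : R -> R -> R) (x r t : R) :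
  is_open_interval T -> T r -> T t ->
  locally x (fun y => forall s, T s ->
    ex_derive (fun y => u y s) y /\ continuous (u y) s) ->
  (forall s, T s ->
    continuous (fun p : R * R => Derive (fun y => u y (snd p)) (fst p)) (x, s)) ->
  is_derive (fun y => RInt (u y) r t) x (RInt (fun s => Derive (fun y => u y s) x) r t).
Proof.
  intros HT Hr Ht Hloc Hc. apply (is_derive_RInt_param u r t x).
  - apply (filter_imp _ _) with (2 := Hloc). intros y Hy s Hs.
    apply Hy. now apply (interval_between T r t).
  - intros s Hs. apply continuity_2d_pt_filterlim. apply Hc.
    now apply (interval_between T r t).
  - apply (filter_imp _ _) with (2 := Hloc). intros y Hy.
    apply (ex_RInt_interval T); auto. intros s Hs. now apply Hy.
Qed.

(** Integrating the mixed derivative in time and differentiating under the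
    integral shows that the space derivative is a primitive of it; in this way the
    existence of the other mixed derivative is a conclusion. *)
Lemma mixed_partials (T : R -> Prop) (u : R -> R -> R) (x t : R) :
  is_open_interval T -> T t ->
  locally x (fun y => forall s, T s ->
    ex_derive (fun y => u y s) y /\
    ex_derive (u y) s /\ continuous (Derive (u y)) s /\
    ex_derive (fun y => Derive (u y) s) y) ->
  (forall s, T s ->
    continuous (fun p : R * R => Derive (fun y => Derive (u y) (snd p)) (fst p)) (x, s)) ->
  is_derive (fun s => Derive (fun y => u y s) x) t
    (Derive (fun y => Derive (u y) t) x).
Proof.
  intros HT Ht Hloc Hc.
  assert (Hx := locally_singleton _ _ Hloc).
  apply (is_derive_ext_loc (fun s => Derive (fun y => u y t) x +
           RInt (fun r => Derive (fun y => Derive (u y) r) x) t s)).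
  - apply (filter_imp T); [|now apply interval_locally]. intros s Hs.
    symmetry. apply is_derive_unique.
    apply (is_derive_ext_loc (fun y => u y t + RInt (Derive (u y)) t s)).
    + apply (filter_imp _ _) with (2 := Hloc). intros y Hy.
      rewrite RInt_Derive.
      * unfold Rminus. rewrite (Rplus_comm (u y s)), <- Rplus_assoc, Rplus_opp_r.
        apply Rplus_0_l.
      * intros r Hr. exact (proj1 (proj2 (Hy r (interval_between T t s r HT Ht Hs Hr)))).
      * intros r Hr.
        exact (proj1 (proj2 (proj2 (Hy r (interval_between T t s r HT Ht Hs Hr))))).
    + apply (is_derive_plus (K := R_AbsRing) (V := R_NormedModule)).
      * apply Derive_correct. exact (proj1 (Hx t Ht)).
      * apply (is_derive_under_RInt T (fun y => Derive (u y))); auto.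
        apply (filter_imp _ _) with (2 := Hloc). intros y Hy r Hr.
        destruct (Hy r Hr) as [_ [_ [Y1 Y2]]]. now split.
  - eapply is_derive_value.
    + apply (is_derive_plus (K := R_AbsRing) (V := R_NormedModule)).
      * apply (is_derive_const (K := R_AbsRing) (V := R_NormedModule)).
      * apply (is_derive_RInt_interval T (fun r => Derive (fun y => Derive (u y) r) x) t t);
          auto.
        intros s Hs.
        now apply (continuous_snd_only (fun y r => Derive (fun y => Derive (u y) r) y)), Hc.
    + apply Rplus_0_l.
Qed.

Lemma is_derive_continuous (g : R -> R) (t l : R) :
  is_derive g t l -> continuous g t.
Proof.
  intros H. apply (ex_derive_continuous (K := R_AbsRing) (V := R_NormedModule)).
  now exists l.
Qed.

Lemma continuous_Rmult (g k : R -> R) (t : R) :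
  continuous g t -> continuous k t -> continuous (fun s => g s * k s) t.
Proof. intros Hg Hk. now apply (continuous_mult (K := R_AbsRing) g k). Qed.

Lemma continuous_Ropp (g : R -> R) (t : R) :
  continuous g t -> continuous (fun s => - g s) t.
Proof. intros Hg. now apply (continuous_opp (K := R_AbsRing) (V := R_NormedModule)). Qed.

(** * Series dominated by a geometric series *)

(** Comparison with the geometric series, whose tail after the term of index
    [n] sums to its [n]-th term because the ratio is [1/2]. *)
Lemma geometric_tail (u : nat -> R) (A : R) :
  (forall n, Rabs (u n) <= A * (1/2) ^ n) ->
  ex_series u /\ forall n, Rabs (sum_n u n - Series u) <= A * (1/2) ^ n.
Proof.
  intros Hu.
  assert (Hg : forall B, is_series (fun n => B * (1/2) ^ n) (B * 2)).
  { intros B. apply (is_series_scal B (fun n => (1/2)^n) 2).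
    assert (G : is_series (fun n => (1/2) ^ n) (/ (1 - 1/2)))
      by (apply is_series_geom; rewrite Rabs_right; lra).
    now replace (/ (1 - 1/2)) with 2 in G by field. }
  assert (Ha : ex_series (fun n => Rabs (u n))).
  { apply (ex_series_le (K := R_AbsRing) (V := R_CompleteNormedModule))
      with (b := fun n => A * (1/2) ^ n); [|eexists; apply Hg].
    intros n. change (Rabs (Rabs (u n)) <= A * (1/2)^n). now rewrite Rabs_Rabsolu. }
  assert (Hex : ex_series u) by now apply ex_series_Rabs.
  split; [exact Hex|]. intros n.
  rewrite (Series_incr_n u (S n)); [|lia|exact Hex]. simpl pred.
  rewrite sum_n_Reals.
  replace (sum_f_R0 u n - _) with (- Series (fun k => u (S n + k)%nat)) by ring.
  rewrite Rabs_Ropp.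
  assert (Ha' : ex_series (fun k => Rabs (u (S n + k)%nat)))
    by now apply (ex_series_incr_n (fun k => Rabs (u k)) (S n)).
  eapply Rle_trans; [now apply Series_Rabs|].
  replace (A * (1/2) ^ n) with (A * (1/2) ^ (S n) * 2) by (simpl; field).
  rewrite <- (is_series_unique _ _ (Hg (A * (1/2) ^ S n))).
  apply Series_le; [|eexists; apply Hg].
  intros k. split; [apply Rabs_pos|].
  rewrite Rmult_assoc, <- pow_add. apply Hu.
Qed.

(** Weierstrass test. *)
Lemma CVU_geometric (u : nat -> R -> R) (D : R -> Prop) (A : R) :
  (forall n t, D t -> Rabs (u n t) <= A * (1/2) ^ n) ->
  CVU_dom (fun n t => sum_n (fun k => u k t) n) D.
Proof.
  intros Hu eps.
  assert (HA : 0 < Rabs A + 1) by (pose proof (Rabs_pos A); lra).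
  destruct (pow_lt_1_zero (1/2)) with (y := eps / (Rabs A + 1)) as [N HN].
  { rewrite Rabs_right; lra. }
  { apply Rdiv_lt_0_compat; [apply cond_pos|exact HA]. }
  exists N. intros n Hn t Ht.
  destruct (geometric_tail (fun k => u k t) A) as [_ H].
  { intros k. now apply Hu. }
  eapply Rle_lt_trans; [apply H|].
  specialize (HN n Hn).
  assert (Hp : 0 < (1/2) ^ n) by (apply pow_lt; lra).
  rewrite Rabs_right in HN by lra.
  apply (Rmult_lt_compat_r (Rabs A + 1)) in HN; [|exact HA].
  unfold Rdiv in HN at 2. rewrite Rmult_assoc, Rinv_l, Rmult_1_r in HN by lra.
  pose proof (Rle_abs A). nra.
Qed.

Lemma is_derive_geometric_series (u w : nat -> R -> R) (l r A : R) :
  (forall n t, l < t < r ->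
     is_derive (u n) t (w n t) /\ continuous (w n) t /\
     Rabs (u n t) <= A * (1/2) ^ n /\ Rabs (w n t) <= A * (1/2) ^ n) ->
  forall t, l < t < r ->
    is_derive (fun s => Series (fun n => u n s)) t (Series (fun n => w n t)).
Proof.
  intros H t Ht.
  set (D := fun s => l < s < r).
  assert (HD : open D) by (apply open_and; [apply open_gt|apply open_lt]).
  assert (Hs : forall n s, D s ->
    is_derive (fun s => sum_n (fun k => u k s) n) s (sum_n (fun k => w k s) n)).
  { intros n s Hs. apply (is_derive_sum_n (K := R_AbsRing) (V := R_NormedModule) u).
    intros k _. now apply H. }
  assert (HDer : forall n s, D s ->
    Derive (fun s => sum_n (fun k => u k s) n) s = sum_n (fun k => w k s) n).
  { intros n s Hs'. apply is_derive_unique. now apply Hs. }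
  unfold Series.
  rewrite <- (Lim_seq_ext (fun n => Derive (fun s => sum_n (fun k => u k s) n) t))
    by (intros n; now apply HDer).
  apply (CVU_Derive (fun n s => sum_n (fun k => u k s) n) D); auto.
  - intros a b x [Ha _] [_ Hb] Hx. unfold D; lra.
  - apply CVU_geometric with (A := A). intros n s Hs'. now apply H.
  - intros n s Hs'. eexists. now apply Hs.
  - intros n s Hs'. apply continuity_pt_filterlim.
    apply (continuous_ext_loc _ (fun s => sum_n (fun k => w k s) n)).
    { apply (filter_imp D); [|now apply HD]. intros x Hx. symmetry. now apply HDer. }
    clear HDer. induction n as [|n IH].
    + apply (continuous_ext (w 0%nat)); [intros x; now rewrite sum_O|]. now apply H.
    + apply (continuous_ext (fun x => sum_n (fun k => w k x) n + w (S n) x)).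
      { intros x. now rewrite sum_Sn. }
      apply (continuous_plus (K := R_AbsRing) (V := R_NormedModule)); [exact IH|now apply H].
  - intros eps.
    destruct (CVU_geometric w D A (fun n s Hs' => proj2 (proj2 (proj2 (H n s Hs')))) eps)
      as [N HN].
    exists N. intros n Hn s Hs'. specialize (HN n Hn s Hs').
    rewrite HDer by exact Hs'.
    rewrite (Lim_seq_ext _ (fun n => sum_n (fun k => w k s) n)); [exact HN|].
    intros m. now apply HDer.
Qed.

(** * Linear second-order equations: Picard iteration *)

Lemma RInt_abs_le_primitive (g b B : R -> R) (r t : R) :
  r <= t ->
  (forall s, r <= s <= t ->
     continuous g s /\ Rabs (g s) <= b s /\ is_derive B s (b s) /\ continuous b s) ->
  Rabs (RInt g r t) <= B t - B r.
Proof.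
  intros Hrt H.
  apply (norm_RInt_le (V := R_NormedModule) g b r t); [exact Hrt| | |].
  - intros s Hs. now apply H.
  - apply (RInt_correct (V := R_CompleteNormedModule)).
    apply (ex_RInt_continuous (V := R_CompleteNormedModule)).
    intros s Hs. rewrite Rmin_left, Rmax_right in Hs by lra. now apply H.
  - apply (is_RInt_derive (V := R_CompleteNormedModule) B b).
    + intros s Hs. rewrite Rmin_left, Rmax_right in Hs by lra. now apply H.
    + intros s Hs. rewrite Rmin_left, Rmax_right in Hs by lra. now apply H.
Qed.

(** Integration from [t0] divides the weight [exp (K |t - t0|)] by [K], on both
    sides of [t0]; for large [K] this makes the Picard operator a contraction on a
    segment of any length. *)
Lemma RInt_exp_bound (K C : R) (g : R -> R) (t0 t : R) :
  0 < K -> 0 <= C ->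
  (forall s, Rmin t0 t <= s <= Rmax t0 t ->
     continuous g s /\ Rabs (g s) <= C * exp (K * Rabs (s - t0))) ->
  Rabs (RInt g t0 t) <= C / K * exp (K * Rabs (t - t0)).
Proof.
  intros HK HC Hg.
  assert (HCK : 0 <= C / K) by (apply Rle_mult_inv_pos; lra).
  assert (Hc : forall e s, continuous (fun s => C * exp (K * (e * (s - t0)))) s).
  { intros e s. apply (ex_derive_continuous (K := R_AbsRing) (V := R_NormedModule)).
    auto_derive. exact I. }
  destruct (Rle_dec t0 t) as [H|H].
  - rewrite Rmin_left, Rmax_right in Hg by lra.
    rewrite (Rabs_right (t - t0)) by lra.
    apply Rle_trans with (C / K * exp (K * (1 * (t - t0)))
                          - C / K * exp (K * (1 * (t0 - t0)))).
    + apply (RInt_abs_le_primitive g (fun s => C * exp (K * (1 * (s - t0))))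
               (fun s => C / K * exp (K * (1 * (s - t0))))); [exact H|].
      intros s Hs. destruct (Hg s Hs) as [H1 H2].
      split; [exact H1|split; [|split; [|apply Hc]]].
      * rewrite (Rabs_right (s - t0)) in H2 by lra. now rewrite Rmult_1_l.
      * auto_derive; [exact I|]. unfold Rminus. field. lra.
    + rewrite !Rmult_1_l.
      assert (0 <= C / K * exp (K * (t0 - t0)))
        by (apply Rmult_le_pos; [exact HCK|left; apply exp_pos]).
      lra.
  - rewrite Rmin_right, Rmax_left in Hg by lra.
    rewrite (Rabs_left (t - t0)) by lra.
    assert (Hex : ex_RInt g t t0).
    { apply (ex_RInt_continuous (V := R_CompleteNormedModule)).
      intros s Hs. rewrite Rmin_left, Rmax_right in Hs by lra. now apply Hg. }
    assert (Hsw : RInt g t0 t = - RInt g t t0)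
      by (symmetry; apply (opp_RInt_swap (V := R_CompleteNormedModule)); exact Hex).
    rewrite Hsw, Rabs_Ropp.
    apply Rle_trans with (- (C / K) * exp (K * (-1 * (t0 - t0)))
                          - (- (C / K)) * exp (K * (-1 * (t - t0)))).
    + apply (RInt_abs_le_primitive g (fun s => C * exp (K * (-1 * (s - t0))))
               (fun s => - (C / K) * exp (K * (-1 * (s - t0))))); [lra|].
      intros s Hs. destruct (Hg s Hs) as [H1 H2].
      split; [exact H1|split; [|split; [|apply Hc]]].
      * rewrite (Rabs_left1 (s - t0)) in H2 by lra.
        now replace (-1 * (s - t0)) with (- (s - t0)) by ring.
      * auto_derive; [exact I|]. unfold Rminus. field. lra.
    + assert (0 <= C / K * exp (K * (-1 * (t0 - t0))))
        by (apply Rmult_le_pos; [exact HCK|left; apply exp_pos]).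
      replace (-1 * (t - t0)) with (- (t - t0)) by ring. lra.
Qed.

Lemma bounded_on_segment (g : R -> R) (l r : R) :
  l <= r -> (forall s, l <= s <= r -> continuous g s) ->
  exists M, 0 <= M /\ forall s, l <= s <= r -> Rabs (g s) <= M.
Proof.
  intros Hlr Hg.
  destruct (continuity_ab_maj (fun s => Rabs (g s)) l r Hlr) as [x [Hx _]].
  { intros s Hs. apply continuity_pt_filterlim.
    apply (continuous_comp g Rabs); [now apply Hg|apply continuous_Rabs]. }
  exists (Rabs (g x)). split; [apply Rabs_pos|exact Hx].
Qed.

(** The successive corrections in Picard's method, starting from the solution
    of [y'' = 0] with value [c] and slope [d] at [t0]; their sum solves
    [y'' + q y = 0]. *)
Fixpoint picard_term (q : R -> R) (t0 c d : R) (n : nat) : R -> R :=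
  match n with
  | O => fun t => c + d * (t - t0)
  | S m => fun t =>
      RInt (fun s => RInt (fun r => - q r * picard_term q t0 c d m r) t0 s) t0 t
  end.

Definition picard_slope (q : R -> R) (t0 c d : R) (n : nat) : R -> R :=
  match n with
  | O => fun _ => d
  | S m => fun t => RInt (fun r => - q r * picard_term q t0 c d m r) t0 t
  end.

Definition picard_accel (q : R -> R) (t0 c d : R) (n : nat) : R -> R :=
  match n with
  | O => fun _ => 0
  | S m => fun t => - q t * picard_term q t0 c d m t
  end.

Lemma picard_derivatives (T : R -> Prop) (q : R -> R) (t0 c d : R) :
  is_open_interval T -> T t0 -> (forall t, T t -> continuous q t) ->
  forall n t, T t ->
    is_derive (picard_term q t0 c d n) t (picard_slope q t0 c d n t) /\
    is_derive (picard_slope q t0 c d n) t (picard_accel q t0 c d n t) /\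
    continuous (picard_accel q t0 c d n) t.
Proof.
  intros HT Ht0 Hq. induction n as [|n IH]; intros t Ht.
  - split; [|split]; simpl.
    + auto_derive; [exact I|ring].
    + apply (is_derive_const (K := R_AbsRing) (V := R_NormedModule)).
    + apply continuous_const.
  - assert (Ha : forall s, T s ->
      continuous (fun r => - q r * picard_term q t0 c d n r) s).
    { intros s Hs. apply continuous_Rmult.
      - now apply continuous_Ropp, Hq.
      - eapply is_derive_continuous. now apply IH. }
    assert (Hs : forall s, T s -> is_derive (picard_slope q t0 c d (S n)) s
                                    (picard_accel q t0 c d (S n) s)).
    { intros s Hs. now apply (is_derive_RInt_interval T _ t0 s HT Ha). }
    split; [|split; [now apply Hs|now apply Ha]].
    apply (is_derive_RInt_interval T (picard_slope q t0 c d (S n)) t0 t HT); auto.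
    intros s Hs'. eapply is_derive_continuous. now apply Hs.
Qed.

(** Two integrations and one multiplication by [q] cost a factor [M / K^2], at
    most [1/2] for the chosen weight. *)
Lemma picard_bounds (q : R -> R) (t0 c d l r K M C : R) :
  l <= t0 <= r -> 0 < K -> 2 * M <= K * K -> 0 <= M ->
  (forall t, l <= t <= r -> continuous q t /\ Rabs (q t) <= M) ->
  (forall t, l <= t <= r -> Rabs (c + d * (t - t0)) <= C) ->
  (forall n t, l <= t <= r -> continuous (picard_term q t0 c d n) t) ->
  (forall n t, l <= t <= r -> continuous (picard_slope q t0 c d n) t) ->
  forall n t, l <= t <= r ->
    Rabs (picard_term q t0 c d n t) <= C * (1/2) ^ n * exp (K * Rabs (t - t0)) /\
    Rabs (picard_slope q t0 c d (S n) t)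
      <= K * (C * (1/2) ^ S n) * exp (K * Rabs (t - t0)).
Proof.
  intros Ht0 HK HKM HM Hq HC Hct Hcs.
  assert (HC0 : 0 <= C) by (eapply Rle_trans; [apply Rabs_pos|apply (HC t0 Ht0)]).
  assert (Hexp : forall t, 1 <= exp (K * Rabs (t - t0))).
  { intros t. rewrite <- exp_0.
    assert (H : 0 <= K * Rabs (t - t0)) by (pose proof (Rabs_pos (t - t0)); nra).
    destruct H as [H|H]; [left; now apply exp_increasing|rewrite <- H; lra]. }
  assert (Hbetween : forall t s, l <= t <= r -> Rmin t0 t <= s <= Rmax t0 t -> l <= s <= r).
  { intros t s Ht. unfold Rmin, Rmax. destruct (Rle_dec t0 t); lra. }
  assert (Hp : forall n, 0 <= C * (1/2) ^ n).
  { intros n. apply Rmult_le_pos; [exact HC0|apply pow_le; lra]. }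
  assert (Hslope : forall n,
    (forall t, l <= t <= r ->
       Rabs (picard_term q t0 c d n t) <= C * (1/2) ^ n * exp (K * Rabs (t - t0))) ->
    forall t, l <= t <= r ->
      Rabs (picard_slope q t0 c d (S n) t)
        <= K * (C * (1/2) ^ S n) * exp (K * Rabs (t - t0))).
  { intros n Hn t Ht. simpl picard_slope.
    apply Rle_trans with (M * (C * (1/2) ^ n) / K * exp (K * Rabs (t - t0))).
    - apply RInt_exp_bound; [exact HK|now apply Rmult_le_pos|].
      intros s Hs. apply (Hbetween t s Ht) in Hs. split.
      + apply continuous_Rmult; [now apply continuous_Ropp, Hq|now apply Hct].
      + rewrite Rabs_mult, Rabs_Ropp, Rmult_assoc.
        apply Rmult_le_compat; try apply Rabs_pos; [now apply Hq|now apply Hn].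
    - apply Rmult_le_compat_r; [left; apply exp_pos|].
      apply Rle_div_l; [exact HK|]. simpl. specialize (Hp n).
      replace (K * (C * (1 / 2 * (1 / 2) ^ n)) * K) with (K * K / 2 * (C * (1/2)^n)) by field.
      apply Rmult_le_compat_r; lra. }
  induction n as [|n IH]; intros t Ht.
  - assert (H0 : forall t, l <= t <= r ->
       Rabs (picard_term q t0 c d 0 t) <= C * (1/2) ^ 0 * exp (K * Rabs (t - t0))).
    { intros s Hs. simpl. specialize (HC s Hs). specialize (Hexp s). nra. }
    split; [now apply H0|now apply Hslope].
  - assert (HS : forall t, l <= t <= r ->
       Rabs (picard_term q t0 c d (S n) t) <= C * (1/2) ^ S n * exp (K * Rabs (t - t0))).
    { intros s Hs. change (picard_term q t0 c d (S n) s)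
        with (RInt (picard_slope q t0 c d (S n)) t0 s).
      replace (C * (1/2) ^ S n) with (K * (C * (1/2) ^ S n) / K) by (field; lra).
      apply RInt_exp_bound; [exact HK|apply Rmult_le_pos; [lra|apply Hp]|].
      intros x Hx. apply (Hbetween s x Hs) in Hx. split; [now apply Hcs|now apply IH]. }
    split; [now apply HS|now apply Hslope].
Qed.

(** Any point of [T] lies with [t0] inside a segment of [T] on which [q] is
    bounded.  There the series of the Picard terms and those of their first and
    second derivatives are all dominated by one geometric series, and can be
    differentiated term by term. *)
Lemma linear_ode_derivatives (T : R -> Prop) (q : R -> R) (t0 c d : R) :
  is_open_interval T -> T t0 -> (forall t, T t -> continuous q t) ->
  let y := fun t => Series (fun n => picard_term q t0 c d n t) in
  let v := fun t => Series (fun n => picard_slope q t0 c d n t) in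
  forall t, T t -> is_derive y t (v t) /\ is_derive v t (- q t * y t).
Proof.
  intros HT Ht0 Hq y v t Ht.
  assert (Hlr : exists l r, T l /\ T r /\ l < t0 < r /\ l < t < r).
  { destruct (interval_locally T t HT Ht) as [e1 H1].
    destruct (interval_locally T t0 HT Ht0) as [e2 H2].
    assert (B : forall x (e : posreal) s, -e < s < e -> ball x e (x + s)).
    { intros x e s Hs. change (Rabs (x + s - x) < e). apply Rabs_def1; lra. }
    pose proof (cond_pos e1) as P1. pose proof (cond_pos e2) as P2.
    exists (Rmin (t + - (e1/2)) (t0 + - (e2/2))), (Rmax (t + e1/2) (t0 + e2/2)).
    split; [|split; [|split]].
    - unfold Rmin; destruct Rle_dec; [apply H1|apply H2]; apply B; lra.
    - unfold Rmax; destruct Rle_dec; [apply H2|apply H1]; apply B; lra.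
    - split; [eapply Rle_lt_trans; [apply Rmin_r|lra]
             |eapply Rlt_le_trans; [|apply Rmax_r]; lra].
    - split; [eapply Rle_lt_trans; [apply Rmin_l|lra]
             |eapply Rlt_le_trans; [|apply Rmax_l]; lra]. }
  destruct Hlr as [l [r [Hl [Hr [H0 H1]]]]].
  assert (HTs : forall s, l <= s <= r -> T s).
  { intros s Hs. destruct HT as [_ [HT _]]. now apply (HT l s r). }
  destruct (bounded_on_segment q l r) as [M [HM HqM]]; [lra|auto|].
  (* K is chosen with 2 M <= K^2; C bounds the initial affine function and its
     slope; A dominates the terms and their first two derivatives. *)
  set (K := 1 + 2 * M). set (C := Rabs c + Rabs d * (1 + (r - l))).
  set (E := exp (K * (r - l))). set (A := C * E * (1 + 2 * K + 2 * M)).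
  assert (HK : 1 <= K) by (unfold K; lra).
  assert (Hc := Rabs_pos c). assert (Hd := Rabs_pos d).
  assert (HC : Rabs d <= C) by (unfold C; nra).
  assert (HE : 1 <= E).
  { unfold E. rewrite <- exp_0. left. apply exp_increasing. nra. }
  assert (HCE : C <= C * E) by nra.
  assert (Hder := picard_derivatives T q t0 c d HT Ht0 Hq).
  assert (Hbound : forall n s, l <= s <= r ->
    Rabs (picard_term q t0 c d n s) <= C * E * (1/2) ^ n /\
    Rabs (picard_slope q t0 c d (S n) s) <= K * (C * E) * (1/2) ^ S n).
  { intros n s Hs.
    assert (HEs : exp (K * Rabs (s - t0)) <= E).
    { unfold E. assert (Hle : K * Rabs (s - t0) <= K * (r - l)).
      { apply Rmult_le_compat_l; [lra|]. apply Rabs_le. lra. }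
      destruct Hle as [Hle|Hle]; [left; now apply exp_increasing|rewrite Hle; lra]. }
    destruct (picard_bounds q t0 c d l r K M C) with (n := n) (t := s) as [B1 B2]; auto.
    - lra.
    - lra.
    - unfold K. nra.
    - intros x Hx. eapply Rle_trans; [apply Rabs_triang|].
      rewrite Rabs_mult. unfold C. apply Rplus_le_compat_l.
      apply Rmult_le_compat_l; [exact Hd|]. apply Rabs_le. lra.
    - intros m x Hx. exact (is_derive_continuous _ _ _ (proj1 (Hder m x (HTs x Hx)))).
    - intros m x Hx. exact (is_derive_continuous _ _ _ (proj1 (proj2 (Hder m x (HTs x Hx))))).
    - assert (Hp : 0 <= (1/2) ^ n) by (apply pow_le; lra).
      assert (Hp' : 0 <= (1/2) ^ S n) by (apply pow_le; lra).
      split.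
      + eapply Rle_trans; [exact B1|].
        replace (C * E * (1/2)^n) with (C * (1/2)^n * E) by ring.
        apply Rmult_le_compat_l; [apply Rmult_le_pos; lra|exact HEs].
      + eapply Rle_trans; [exact B2|].
        replace (K * (C * E) * (1/2)^S n) with (K * (C * (1/2)^S n) * E) by ring.
        apply Rmult_le_compat_l; [|exact HEs].
        apply Rmult_le_pos; [lra|apply Rmult_le_pos; lra]. }
  assert (HA : forall x p, 0 <= p -> x <= C * E * (1 + 2 * K + 2 * M) -> x * p <= A * p).
  { intros x p Hp Hx. now apply Rmult_le_compat_r. }
  assert (Hpow : forall n, 0 <= (1/2) ^ n) by (intros; apply pow_le; lra).
  assert (Hterm : forall n s, l < s < r ->
    Rabs (picard_term q t0 c d n s) <= A * (1/2) ^ n).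
  { intros n s Hs. eapply Rle_trans; [apply Hbound; lra|]. apply HA; [apply Hpow|]. nra. }
  assert (Hslope : forall n s, l < s < r ->
    Rabs (picard_slope q t0 c d n s) <= A * (1/2) ^ n).
  { intros [|n] s Hs.
    - simpl picard_slope. replace (Rabs d) with (Rabs d * (1/2)^0) by (simpl; ring).
      apply HA; [apply Hpow|]. nra.
    - eapply Rle_trans; [apply Hbound; lra|]. apply HA; [apply Hpow|]. nra. }
  assert (Haccel : forall n s, l < s < r ->
    Rabs (picard_accel q t0 c d n s) <= A * (1/2) ^ n).
  { intros [|n] s Hs.
    - simpl picard_accel. rewrite Rabs_R0. apply Rmult_le_pos; [|apply Hpow].
      unfold A. nra.
    - simpl picard_accel. rewrite Rabs_mult, Rabs_Ropp.
      apply Rle_trans with (M * (C * E * (1/2) ^ n)).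
      + apply Rmult_le_compat; try apply Rabs_pos; [apply HqM; lra|apply Hbound; lra].
      + replace (M * (C * E * (1/2) ^ n)) with (2 * M * (C * E) * (1/2) ^ S n)
          by (simpl; field).
        apply HA; [apply Hpow|]. nra. }
  split.
  - apply (is_derive_geometric_series _ _ l r A); [|exact H1].
    intros n s Hs. destruct (Hder n s) as [D1 [D2 D3]]; [apply HTs; lra|].
    split; [exact D1|split; [exact (is_derive_continuous _ _ _ D2)|]].
    split; [now apply Hterm|now apply Hslope].
  - assert (Hv : is_derive v t (Series (fun n => picard_accel q t0 c d n t))).
    { apply (is_derive_geometric_series _ _ l r A); [|exact H1].
      intros n s Hs. destruct (Hder n s) as [D1 [D2 D3]]; [apply HTs; lra|].
      split; [exact D2|split; [exact D3|]].
      split; [now apply Hslope|now apply Haccel]. }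
    apply (is_derive_value _ _ _ _ Hv).
    rewrite Series_incr_1.
    + simpl. rewrite Rplus_0_l. apply (Series_scal_l (- q t)).
    + apply (geometric_tail _ A). intros n. now apply Haccel.
Qed.

(** At [t0] all corrections but the initial one vanish with their slopes. *)
Lemma ode_initial_value (T : R -> Prop) (q : R -> R) (t0 c d : R) :
  is_open_interval T -> T t0 -> (forall t, T t -> continuous q t) ->
  exists y, ode_solution T q y /\ y t0 = c /\ Derive y t0 = d.
Proof.
  intros HT Ht0 Hq.
  assert (H := linear_ode_derivatives T q t0 c d HT Ht0 Hq). simpl in H.
  set (y := fun t => Series (fun n => picard_term q t0 c d n t)) in *.
  set (v := fun t => Series (fun n => picard_slope q t0 c d n t)) in *.
  assert (Hyv : forall t, T t -> Derive y t = v t).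
  { intros t Ht. apply is_derive_unique. now apply H. }
  assert (Hval : forall u : nat -> R, (forall n, u (S n) = 0) -> Series u = u 0%nat).
  { intros u Hu. destruct (geometric_tail u (Rabs (u 0%nat))) as [Hex _].
    - intros [|n].
      + simpl. lra.
      + rewrite Hu, Rabs_R0. apply Rmult_le_pos; [apply Rabs_pos|apply pow_le; lra].
    - rewrite Series_incr_1 by exact Hex.
      rewrite (Series_ext _ (fun n => 0 * u n)) by (intros n; rewrite Hu; ring).
      rewrite Series_scal_l. ring. }
  exists y. split; [|split].
  - intros t Ht. destruct (H t Ht) as [H1 H2].
    assert (H3 : is_derive (Derive y) t (- q t * y t)).
    { apply (is_derive_ext_loc v); [|exact H2].
      apply (filter_imp T); [|now apply interval_locally].
      intros s Hs. symmetry. now apply Hyv. }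
    split; [now eexists; apply H1|split; [now eexists; apply H3|]].
    rewrite (is_derive_unique _ _ _ H3). ring.
  - unfold y. rewrite Hval; [simpl; ring|].
    intros n. apply (RInt_point (V := R_CompleteNormedModule)).
  - rewrite Hyv by exact Ht0. unfold v. rewrite Hval; [reflexivity|].
    intros n. apply (RInt_point (V := R_CompleteNormedModule)).
Qed.

(** * Linear second-order equations: the Wronskian *)

Lemma ode_solution_derives (T : R -> Prop) (q y : R -> R) (t : R) :
  ode_solution T q y -> T t ->
  is_derive y t (Derive y t) /\ is_derive (Derive y) t (- q t * y t).
Proof.
  intros Hy Ht. destruct (Hy t Ht) as [H1 [H2 H3]].
  split; [now apply Derive_correct|].
  apply (is_derive_value _ _ (Derive (Derive y) t)); [now apply Derive_correct|lra].
Qed.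

Definition wronskian (y1 y2 : R -> R) (t : R) : R :=
  y1 t * Derive y2 t - Derive y1 t * y2 t.

Lemma wronskian_constant (T : R -> Prop) (q y1 y2 : R -> R) :
  is_open_interval T -> ode_solution T q y1 -> ode_solution T q y2 ->
  forall s t, T s -> T t -> wronskian y1 y2 s = wronskian y1 y2 t.
Proof.
  intros HT H1 H2. apply (constant_of_zero_derivative T _ HT). intros t Ht.
  destruct (ode_solution_derives T q y1 t H1 Ht) as [A1 B1].
  destruct (ode_solution_derives T q y2 t H2 Ht) as [A2 B2].
  eapply is_derive_value.
  - apply (is_derive_minus (K := R_AbsRing) (V := R_NormedModule)).
    + apply (is_derive_mult (K := R_AbsRing) y1 (Derive y2)); eauto. intros; apply Rmult_comm.
    + apply (is_derive_mult (K := R_AbsRing) (Derive y1) y2); eauto. intros; apply Rmult_comm.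
  - unfold minus, plus, opp, mult; simpl. ring.
Qed.

Lemma ode_fundamental_pair (T : R -> Prop) (q : R -> R) (t0 : R) :
  is_open_interval T -> T t0 -> (forall t, T t -> continuous q t) ->
  exists e1 e2, ode_solution T q e1 /\ ode_solution T q e2 /\
    e1 t0 = 1 /\ Derive e1 t0 = 0 /\ e2 t0 = 0 /\ Derive e2 t0 = 1.
Proof.
  intros HT Ht0 Hq.
  destruct (ode_initial_value T q t0 1 0 HT Ht0 Hq) as [e1 [H1 [H2 H3]]].
  destruct (ode_initial_value T q t0 0 1 HT Ht0 Hq) as [e2 [H4 [H5 H6]]].
  exists e1, e2. tauto.
Qed.

(** Cramer's rule for the system expressing [y] and its derivative at [t]; the
    three determinants are Wronskians and may be evaluated at [t0]. *)
Lemma ode_expansion (T : R -> Prop) (q y1 y2 y : R -> R) (t0 t : R) :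
  is_open_interval T -> T t0 -> T t ->
  ode_solution T q y1 -> ode_solution T q y2 -> ode_solution T q y ->
  wronskian y1 y2 t0 <> 0 ->
  y t = y1 t * (wronskian y y2 t0 / wronskian y1 y2 t0)
        + y2 t * (wronskian y1 y t0 / wronskian y1 y2 t0).
Proof.
  intros HT Ht0 Ht H1 H2 H HW.
  rewrite (wronskian_constant T q y1 y2 HT H1 H2 t0 t Ht0 Ht) in *.
  rewrite (wronskian_constant T q y y2 HT H H2 t0 t Ht0 Ht).
  rewrite (wronskian_constant T q y1 y HT H1 H t0 t Ht0 Ht).
  unfold wronskian in *. field. exact HW.
Qed.

(** Expanding in the fundamental pair at [t0] identifies solutions with their
    initial data.  When the Wronskian vanishes, the coefficients of two linear
    relations can be read off the data of [y1] and [y2]; independence makes those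
    data zero, hence [y1 = 0], which is itself a relation. *)
Lemma wronskian_lin_indep (T : R -> Prop) (q y1 y2 : R -> R) (t0 : R) :
  is_open_interval T -> T t0 -> (forall t, T t -> continuous q t) ->
  ode_solution T q y1 -> ode_solution T q y2 -> lin_indep T y1 y2 ->
  wronskian y1 y2 t0 <> 0.
Proof.
  intros HT Ht0 Hq H1 H2 Hind HW.
  destruct (ode_fundamental_pair T q t0 HT Ht0 Hq)
    as [e1 [e2 [E1 [E2 [V1 [D1 [V2 D2]]]]]]].
  assert (Hrep : forall y, ode_solution T q y -> forall t, T t ->
                   y t = e1 t * y t0 + e2 t * Derive y t0).
  { intros y Hy t Ht.
    rewrite (ode_expansion T q e1 e2 y t0 t HT Ht0 Ht E1 E2 Hy);
      unfold wronskian; rewrite V1, D1, V2, D2; [field|lra]. }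
  unfold wronskian in HW.
  (* This relation cancels the e2 component, the next one the e1 component. *)
  destruct (Hind (Derive y2 t0) (- Derive y1 t0)) as [K1 K2].
  { intros t Ht. rewrite (Hrep y1 H1 t Ht), (Hrep y2 H2 t Ht).
    replace (_ + _) with (e1 t * (y1 t0 * Derive y2 t0 - Derive y1 t0 * y2 t0)) by ring.
    rewrite HW. ring. }
  destruct (Hind (y2 t0) (- y1 t0)) as [K3 K4].
  { intros t Ht. rewrite (Hrep y1 H1 t Ht), (Hrep y2 H2 t Ht).
    replace (_ + _) with (- e2 t * (y1 t0 * Derive y2 t0 - Derive y1 t0 * y2 t0)) by ring.
    rewrite HW. ring. }
  destruct (Hind 1 0) as [K5 _]; [|lra].
  intros t Ht. rewrite (Hrep y1 H1 t Ht).
  replace (y1 t0) with 0 by lra. replace (Derive y1 t0) with 0 by lra. ring.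
Qed.

Lemma fundamental_pair_lin_indep (T : R -> Prop) (t0 : R) (e1 e2 : R -> R) :
  is_open_interval T -> T t0 -> ex_derive e1 t0 -> ex_derive e2 t0 ->
  wronskian e1 e2 t0 <> 0 -> lin_indep T e1 e2.
Proof.
  intros HT Ht0 X1 X2 HW k1 k2 Hk.
  assert (H0 := Hk t0 Ht0).
  assert (HD : k1 * Derive e1 t0 + k2 * Derive e2 t0 = 0).
  { rewrite <- !Derive_scal, <- Derive_plus.
    - rewrite (Derive_ext_loc _ (fun _ => 0)); [apply Derive_const|].
      apply (filter_imp T); [exact Hk|now apply interval_locally].
    - now apply (ex_derive_scal e1).
    - now apply (ex_derive_scal e2). }
  unfold wronskian in HW. split.
  - apply (Rmult_eq_reg_r (e1 t0 * Derive e2 t0 - Derive e1 t0 * e2 t0)); [|exact HW].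
    transitivity (Derive e2 t0 * (k1 * e1 t0 + k2 * e2 t0)
                  - e2 t0 * (k1 * Derive e1 t0 + k2 * Derive e2 t0)); [ring|].
    rewrite H0, HD. ring.
  - apply (Rmult_eq_reg_r (e1 t0 * Derive e2 t0 - Derive e1 t0 * e2 t0)); [|exact HW].
    transitivity (e1 t0 * (k1 * Derive e1 t0 + k2 * Derive e2 t0)
                  - Derive e1 t0 * (k1 * e1 t0 + k2 * e2 t0)); [ring|].
    rewrite H0, HD. ring.
Qed.

Lemma ode_solution_combination (T : R -> Prop) (q y1 y2 y : R -> R) (k1 k2 : R) :
  is_open_interval T -> ode_solution T q y1 -> ode_solution T q y2 ->
  (forall t, T t -> y t = y1 t * k1 + y2 t * k2) -> ode_solution T q y.
Proof.
  intros HT H1 H2 Hy.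
  assert (L : forall u u1 u2 : R -> R, (forall t, T t -> u t = u1 t * k1 + u2 t * k2) ->
    forall t (l1 l2 : R), T t -> is_derive u1 t l1 -> is_derive u2 t l2 ->
      is_derive u t (l1 * k1 + l2 * k2)).
  { intros u u1 u2 Hu t l1 l2 Ht D1 D2.
    apply (is_derive_ext_loc (fun s => k1 * u1 s + k2 * u2 s)).
    - apply (filter_imp T); [|now apply interval_locally]. intros s Hs.
      rewrite Hu by exact Hs. rewrite (Rmult_comm k1), (Rmult_comm k2). reflexivity.
    - apply (is_derive_value _ _ (k1 * l1 + k2 * l2)); [|ring].
      apply (is_derive_plus (K := R_AbsRing) (V := R_NormedModule)).
      + now apply (is_derive_scal u1).
      + now apply (is_derive_scal u2). }
  assert (Hd : forall t, T t ->
    is_derive y t (Derive y1 t * k1 + Derive y2 t * k2)).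
  { intros t Ht. apply (L y y1 y2 Hy t _ _ Ht); eapply ode_solution_derives; eauto. }
  intros t Ht.
  assert (Hdd : is_derive (Derive y) t ((- q t * y1 t) * k1 + (- q t * y2 t) * k2)).
  { apply (L (Derive y) (Derive y1) (Derive y2)); auto.
    - intros s Hs. apply is_derive_unique. now apply Hd.
    - now apply (ode_solution_derives T q y1).
    - now apply (ode_solution_derives T q y2). }
  split; [eexists; now apply Hd|split; [now eexists; apply Hdd|]].
  rewrite (is_derive_unique _ _ _ Hdd), (Hy t Ht). ring.
Qed.

Lemma ode_solution_C2 (T : R -> Prop) (q y : R -> R) :
  is_open_interval T -> (forall t, T t -> continuous q t) ->
  ode_solution T q y -> C2_on T y.
Proof.
  intros HT Hq Hy t Ht. destruct (Hy t Ht) as [H1 [H2 _]].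
  split; [exact H1|split; [exact H2|]].
  apply (continuous_ext_loc _ (fun s => - q s * y s)).
  - apply (filter_imp T); [|now apply interval_locally]. intros s Hs.
    destruct (Hy s Hs) as [_ [_ H3]]. lra.
  - apply continuous_Rmult; [now apply continuous_Ropp, Hq|].
    now apply (ex_derive_continuous (K := R_AbsRing) (V := R_NormedModule)).
Qed.

(** * Regularity classes of fields *)

Lemma open_line1 (D : vec -> Prop) (z : vec) :
  open D -> D z -> locally (crd1 z) (fun x => D (x, crd2 z, crd3 z)).
Proof.
  intros HD Hz. destruct (HD z Hz) as [e He]. exists e. intros x Hx.
  apply He. split; [split|]; [exact Hx|apply ball_center|apply ball_center].
Qed.

Lemma open_line2 (D : vec -> Prop) (z : vec) :
  open D -> D z -> locally (crd2 z) (fun x => D (crd1 z, x, crd3 z)).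
Proof.
  intros HD Hz. destruct (HD z Hz) as [e He]. exists e. intros x Hx.
  apply He. split; [split|]; [apply ball_center|exact Hx|apply ball_center].
Qed.

Lemma open_line3 (D : vec -> Prop) (z : vec) :
  open D -> D z -> locally (crd3 z) (fun x => D (crd1 z, crd2 z, x)).
Proof.
  intros HD Hz. destruct (HD z Hz) as [e He]. exists e. intros x Hx.
  apply He. split; [split|]; [apply ball_center|apply ball_center|exact Hx].
Qed.

Definition eq_on (D : vec -> Prop) (T : R -> Prop) (u v : sfield) : Prop :=
  forall z t, D z -> T t -> u z t = v z t.

Lemma pd_ext (D : vec -> Prop) (T : R -> Prop) (u v : sfield) :
  open D -> eq_on D T u v ->
  eq_on D T (pd1 u) (pd1 v) /\ eq_on D T (pd2 u) (pd2 v) /\ eq_on D T (pd3 u) (pd3 v).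
Proof.
  intros HD Huv. repeat split; intros z t Hz Ht; apply Derive_ext_loc.
  - apply (filter_imp _ _) with (2 := open_line1 D z HD Hz). intros x Hx. now apply Huv.
  - apply (filter_imp _ _) with (2 := open_line2 D z HD Hz). intros x Hx. now apply Huv.
  - apply (filter_imp _ _) with (2 := open_line3 D z HD Hz). intros x Hx. now apply Huv.
Qed.

Lemma dt_ext (D : vec -> Prop) (T : R -> Prop) (u v : sfield) :
  is_open_interval T -> eq_on D T u v -> eq_on D T (dt u) (dt v).
Proof.
  intros HT Huv z t Hz Ht. apply Derive_ext_loc.
  apply (filter_imp T); [|now apply interval_locally]. intros s Hs. now apply Huv.
Qed.

Lemma ex_dt_ext (D : vec -> Prop) (T : R -> Prop) (u v : sfield) :
  is_open_interval T -> eq_on D T u v -> ex_dt D T u -> ex_dt D T v.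
Proof.
  intros HT Huv Hu z t Hz Ht. apply (ex_derive_ext_loc (u z)); [|now apply Hu].
  apply (filter_imp T); [|now apply interval_locally]. intros s Hs. now apply Huv.
Qed.

Lemma cont_on_ext (D : vec -> Prop) (T : R -> Prop) (u v : sfield) :
  open D -> open T -> eq_on D T u v -> cont_on D T u -> cont_on D T v.
Proof.
  intros HD HT Huv Hu z t Hz Ht.
  apply (continuous_ext_loc _ (fun p : vec * R => u (fst p) (snd p))); [|now apply Hu].
  assert (H1 : locally (z, t) (fun p : vec * R => D (fst p))).
  { apply (continuous_fst z t). now apply HD. }
  assert (H2 : locally (z, t) (fun p : vec * R => T (snd p))).
  { apply (continuous_snd z t). now apply HT. }
  assert (HF := filter_filter (ProperFilter := locally_filter (z, t))).
  apply (@filter_imp _ _ HF _ _) with (2 := @filter_and _ _ HF _ _ H1 H2).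
  intros p [Hp1 Hp2]. now apply Huv.
Qed.

Lemma C1_space_ext (D : vec -> Prop) (T : R -> Prop) (u v : sfield) :
  open D -> is_open_interval T -> eq_on D T u v -> C1_space D T u -> C1_space D T v.
Proof.
  intros HD HT Huv [Hex [Hc [H1 [H2 H3]]]].
  destruct (pd_ext D T u v HD Huv) as [E1 [E2 E3]].
  assert (HT' := proj1 HT).
  split; [|split; [|split; [|split]]].
  - intros z t Hz Ht. destruct (Hex z t Hz Ht) as [X1 [X2 X3]].
    split; [|split]; eapply ex_derive_ext_loc; try eassumption.
    + apply (filter_imp _ _) with (2 := open_line1 D z HD Hz). intros x Hx. now apply Huv.
    + apply (filter_imp _ _) with (2 := open_line2 D z HD Hz). intros x Hx. now apply Huv.
    + apply (filter_imp _ _) with (2 := open_line3 D z HD Hz). intros x Hx. now apply Huv.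
  - now apply (cont_on_ext D T u).
  - now apply (cont_on_ext D T (pd1 u)).
  - now apply (cont_on_ext D T (pd2 u)).
  - now apply (cont_on_ext D T (pd3 u)).
Qed.

Lemma C1_space_C2_time_ext (D : vec -> Prop) (T : R -> Prop) (u v : sfield) :
  open D -> is_open_interval T -> eq_on D T u v ->
  C1_space_C2_time D T u -> C1_space_C2_time D T v.
Proof.
  intros HD HT Huv [H0 [X1 [H1 [X2 H2]]]].
  assert (E1 := dt_ext D T u v HT Huv). assert (E2 := dt_ext D T _ _ HT E1).
  split; [|split; [|split; [|split]]].
  - now apply (C1_space_ext D T u).
  - now apply (ex_dt_ext D T u).
  - now apply (C1_space_ext D T (dt u)).
  - now apply (ex_dt_ext D T (dt u)).
  - now apply (C1_space_ext D T (dt (dt u))).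
Qed.

Lemma cont_on_plus (D : vec -> Prop) (T : R -> Prop) (u v : sfield) :
  cont_on D T u -> cont_on D T v -> cont_on D T (fun z t => u z t + v z t).
Proof.
  intros Hu Hv z t Hz Ht.
  exact (continuous_plus (K := R_AbsRing) (V := R_NormedModule)
           (fun p : vec * R => u (fst p) (snd p)) (fun p => v (fst p) (snd p)) _
           (Hu z t Hz Ht) (Hv z t Hz Ht)).
Qed.

Lemma pd_plus (D : vec -> Prop) (T : R -> Prop) (u v : sfield) :
  C1_space D T u -> C1_space D T v ->
  eq_on D T (fun z t => pd1 u z t + pd1 v z t) (pd1 (fun z t => u z t + v z t)) /\
  eq_on D T (fun z t => pd2 u z t + pd2 v z t) (pd2 (fun z t => u z t + v z t)) /\
  eq_on D T (fun z t => pd3 u z t + pd3 v z t) (pd3 (fun z t => u z t + v z t)).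
Proof.
  intros [Hu _] [Hv _].
  split; [|split]; intros z t Hz Ht; symmetry;
    destruct (Hu z t Hz Ht) as [U1 [U2 U3]]; destruct (Hv z t Hz Ht) as [V1 [V2 V3]].
  - exact (Derive_plus _ _ _ U1 V1).
  - exact (Derive_plus _ _ _ U2 V2).
  - exact (Derive_plus _ _ _ U3 V3).
Qed.

Lemma C1_space_plus (D : vec -> Prop) (T : R -> Prop) (u v : sfield) :
  open D -> open T -> C1_space D T u -> C1_space D T v ->
  C1_space D T (fun z t => u z t + v z t).
Proof.
  intros HD HT Hu Hv. destruct (pd_plus D T u v Hu Hv) as [E1 [E2 E3]].
  destruct Hu as [Xu [Cu [U1 [U2 U3]]]]. destruct Hv as [Xv [Cv [V1 [V2 V3]]]].
  split; [|split; [|split; [|split]]].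
  - intros z t Hz Ht.
    destruct (Xu z t Hz Ht) as [A1 [A2 A3]]. destruct (Xv z t Hz Ht) as [B1 [B2 B3]].
    split; [|split].
    + exact (ex_derive_plus (K := R_AbsRing) (V := R_NormedModule) _ _ _ A1 B1).
    + exact (ex_derive_plus (K := R_AbsRing) (V := R_NormedModule) _ _ _ A2 B2).
    + exact (ex_derive_plus (K := R_AbsRing) (V := R_NormedModule) _ _ _ A3 B3).
  - now apply cont_on_plus.
  - eapply cont_on_ext; eauto. now apply cont_on_plus.
  - eapply cont_on_ext; eauto. now apply cont_on_plus.
  - eapply cont_on_ext; eauto. now apply cont_on_plus.
Qed.

Lemma dt_plus (D : vec -> Prop) (T : R -> Prop) (u v : sfield) :
  ex_dt D T u -> ex_dt D T v ->
  eq_on D T (fun z t => dt u z t + dt v z t) (dt (fun z t => u z t + v z t)).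
Proof.
  intros Hu Hv z t Hz Ht. symmetry.
  exact (Derive_plus _ _ _ (Hu z t Hz Ht) (Hv z t Hz Ht)).
Qed.

Lemma ex_dt_plus (D : vec -> Prop) (T : R -> Prop) (u v : sfield) :
  ex_dt D T u -> ex_dt D T v -> ex_dt D T (fun z t => u z t + v z t).
Proof.
  intros Hu Hv z t Hz Ht.
  exact (ex_derive_plus (K := R_AbsRing) (V := R_NormedModule) _ _ _
           (Hu z t Hz Ht) (Hv z t Hz Ht)).
Qed.

Lemma C1_space_C2_time_plus (D : vec -> Prop) (T : R -> Prop) (u v : sfield) :
  open D -> is_open_interval T -> C1_space_C2_time D T u -> C1_space_C2_time D T v ->
  C1_space_C2_time D T (fun z t => u z t + v z t).
Proof.
  intros HD HT [U0 [XU1 [U1 [XU2 U2]]]] [V0 [XV1 [V1 [XV2 V2]]]].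
  assert (HT' := proj1 HT).
  assert (E1 := dt_plus D T u v XU1 XV1).
  assert (E2 : eq_on D T (fun z t => dt (dt u) z t + dt (dt v) z t)
                         (dt (dt (fun z t => u z t + v z t)))).
  { intros z t Hz Ht. rewrite <- (dt_ext D T _ _ HT E1 z t Hz Ht).
    now apply (dt_plus D T). }
  split; [|split; [|split; [|split]]].
  - now apply C1_space_plus.
  - now apply ex_dt_plus.
  - eapply C1_space_ext; eauto. now apply C1_space_plus.
  - eapply ex_dt_ext; eauto. now apply ex_dt_plus.
  - eapply C1_space_ext; eauto. now apply C1_space_plus.
Qed.

Lemma C1_space_scal (D : vec -> Prop) (T : R -> Prop) (b : R -> R) (u : sfield) :
  (forall t, T t -> continuous b t) -> C1_space D T u ->
  C1_space D T (fun z t => b t * u z t).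
Proof.
  intros Hb [Xu [Cu [U1 [U2 U3]]]].
  assert (HC : forall v, cont_on D T v -> cont_on D T (fun z t => b t * v z t)).
  { intros v Hv z t Hz Ht.
    apply (continuous_mult (K := R_AbsRing) (fun p : vec * R => b (snd p))
             (fun p => v (fst p) (snd p))); [|exact (Hv z t Hz Ht)].
    apply (continuous_comp snd b); [apply continuous_snd|exact (Hb t Ht)]. }
  assert (HP : forall (v w : sfield), (forall z t, b t * v z t = w z t) ->
             cont_on D T v -> cont_on D T w).
  { intros v w E Hv z t Hz Ht.
    apply (continuous_ext (fun p : vec * R => b (snd p) * v (fst p) (snd p)));
      [intros p; apply E|now apply HC]. }
  split; [|split; [|split; [|split]]].
  - intros z t Hz Ht. destruct (Xu z t Hz Ht) as [A1 [A2 A3]].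
    split; [|split].
    + exact (ex_derive_scal _ (b t) _ A1).
    + exact (ex_derive_scal _ (b t) _ A2).
    + exact (ex_derive_scal _ (b t) _ A3).
  - now apply HC.
  - apply (HP (pd1 u)); [|exact U1]. intros z t. symmetry. apply Derive_scal.
  - apply (HP (pd2 u)); [|exact U2]. intros z t. symmetry. apply Derive_scal.
  - apply (HP (pd3 u)); [|exact U3]. intros z t. symmetry. apply Derive_scal.
Qed.

Lemma C2_on_continuous (T : R -> Prop) (b : R -> R) :
  C2_on T b -> forall t, T t -> continuous b t /\ continuous (Derive b) t.
Proof.
  intros Hb t Ht. destruct (Hb t Ht) as [H1 [H2 _]].
  split; now apply (ex_derive_continuous (K := R_AbsRing) (V := R_NormedModule)).
Qed.

(** Separated variables: only the time factor is differentiated in time. *)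
Lemma C1_space_C2_time_scal (D : vec -> Prop) (T : R -> Prop) (b : R -> R) (w : vec -> R) :
  open D -> is_open_interval T -> C2_on T b -> C1_space D T (fun z _ => w z) ->
  C1_space_C2_time D T (fun z t => b t * w z).
Proof.
  intros HD HT Hb Hw.
  assert (E1 : eq_on D T (fun z t => Derive b t * w z) (dt (fun z t => b t * w z))).
  { intros z t _ _. symmetry. apply Derive_scal_l. }
  assert (E2 : eq_on D T (fun z t => Derive (Derive b) t * w z)
                 (dt (dt (fun z t => b t * w z)))).
  { intros z t Hz Ht. rewrite <- (dt_ext D T _ _ HT E1 z t Hz Ht).
    symmetry. apply Derive_scal_l. }
  assert (X : forall g : R -> R, (forall t, T t -> ex_derive g t) ->
            ex_dt D T (fun z t => g t * w z)).
  { intros g Hg z t Hz Ht.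
    apply (ex_derive_ext (fun s => w z * g s)); [intros s; apply Rmult_comm|].
    apply (ex_derive_scal g). now apply Hg. }
  split; [|split; [|split; [|split]]].
  - apply (C1_space_scal D T b (fun z _ => w z)); [|exact Hw].
    intros t Ht. now apply (C2_on_continuous T).
  - apply X. intros t Ht. now apply Hb.
  - eapply C1_space_ext; eauto. apply (C1_space_scal D T _ (fun z _ => w z)); [|exact Hw].
    intros t Ht. now apply (C2_on_continuous T).
  - eapply ex_dt_ext; eauto. apply X. intros t Ht. now apply Hb.
  - eapply C1_space_ext; eauto. apply (C1_space_scal D T _ (fun z _ => w z)); [|exact Hw].
    intros t Ht. now apply Hb.
Qed.

Lemma cont_on_fixed_time (D : vec -> Prop) (T : R -> Prop) (u : sfield) (t0 : R) :
  T t0 -> cont_on D T u -> cont_on D T (fun z _ => u z t0).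
Proof.
  intros Ht0 Hu z t Hz Ht.
  apply (continuous_comp_2 (fun p : vec * R => fst p) (fun _ => t0) u);
    [apply continuous_fst|apply continuous_const|now apply Hu].
Qed.

Lemma C1_space_fixed_time (D : vec -> Prop) (T : R -> Prop) (u : sfield) (t0 : R) :
  T t0 -> C1_space D T u -> C1_space D T (fun z _ => u z t0).
Proof.
  intros Ht0 [Xu [Cu [U1 [U2 U3]]]].
  split; [|split; [|split; [|split]]].
  - intros z t Hz _. exact (Xu z t0 Hz Ht0).
  - now apply cont_on_fixed_time.
  - now apply (cont_on_fixed_time D T (pd1 u)).
  - now apply (cont_on_fixed_time D T (pd2 u)).
  - now apply (cont_on_fixed_time D T (pd3 u)).
Qed.

Lemma cont_on_time (D : vec -> Prop) (T : R -> Prop) (u : sfield) (z : vec) (t : R) :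
  cont_on D T u -> D z -> T t -> continuous (u z) t.
Proof.
  intros Hu Hz Ht. apply (continuous_comp_2 (fun _ : R => z) (fun s : R => s) u t);
    [apply continuous_const|apply continuous_id|now apply Hu].
Qed.

Lemma cont_on_line1 (D : vec -> Prop) (T : R -> Prop) (u : sfield) (z : vec) (t : R) :
  cont_on D T u -> D z -> T t ->
  continuous (fun p : R * R => u (fst p, crd2 z, crd3 z) (snd p)) (crd1 z, t).
Proof.
  intros Hu Hz Ht.
  apply (continuous_comp_2 (fun p : R * R => (fst p, crd2 z, crd3 z) : vec) snd u).
  - apply (continuous_pair (fun p : R * R => (fst p, crd2 z)));
      [apply continuous_pair; [apply continuous_fst|]|]; apply continuous_const.
  - apply continuous_snd.
  - destruct z as [[z1 z2] z3]. now apply Hu.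
Qed.

Lemma cont_on_line2 (D : vec -> Prop) (T : R -> Prop) (u : sfield) (z : vec) (t : R) :
  cont_on D T u -> D z -> T t ->
  continuous (fun p : R * R => u (crd1 z, fst p, crd3 z) (snd p)) (crd2 z, t).
Proof.
  intros Hu Hz Ht.
  apply (continuous_comp_2 (fun p : R * R => (crd1 z, fst p, crd3 z) : vec) snd u).
  - apply (continuous_pair (fun p : R * R => (crd1 z, fst p)));
      [apply continuous_pair; [|apply continuous_fst]|]; apply continuous_const.
  - apply continuous_snd.
  - destruct z as [[z1 z2] z3]. now apply Hu.
Qed.

(** * Interchanging derivatives and integrals of fields *)

Lemma pd_dt_commute (D : vec -> Prop) (T : R -> Prop) (u : sfield) :
  open D -> is_open_interval T -> C1_space D T u -> ex_dt D T u -> C1_space D T (dt u) ->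
  forall z t, D z -> T t ->
    is_derive (pd1 u z) t (pd1 (dt u) z t) /\ is_derive (pd2 u z) t (pd2 (dt u) z t).
Proof.
  intros HD HT [Xu _] Xt [Xdu [Cdu [C1 [C2 _]]]] z t Hz Ht.
  split.
  - apply (mixed_partials T (fun x s => u (x, crd2 z, crd3 z) s) (crd1 z) t HT Ht).
    + apply (filter_imp _ _) with (2 := open_line1 D z HD Hz). intros x Hx s Hs.
      split; [exact (proj1 (Xu _ s Hx Hs))|split; [now apply Xt|split]].
      * now apply (cont_on_time D T (dt u)).
      * exact (proj1 (Xdu _ s Hx Hs)).
    + intros s Hs. now apply (cont_on_line1 D T (pd1 (dt u))).
  - apply (mixed_partials T (fun x s => u (crd1 z, x, crd3 z) s) (crd2 z) t HT Ht).
    + apply (filter_imp _ _) with (2 := open_line2 D z HD Hz). intros x Hx s Hs.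
      split; [exact (proj1 (proj2 (Xu _ s Hx Hs)))|split; [now apply Xt|split]].
      * now apply (cont_on_time D T (dt u)).
      * exact (proj1 (proj2 (Xdu _ s Hx Hs))).
    + intros s Hs. now apply (cont_on_line2 D T (pd2 (dt u))).
Qed.

(** The gradient of the time integral is needed in the two horizontal directions
    only, since the gradient of the density is vertical. *)
Lemma pd_RInt (D : vec -> Prop) (T : R -> Prop) (u : sfield) (t0 : R) :
  open D -> is_open_interval T -> T t0 -> C1_space D T u ->
  eq_on D T (pd1 (fun z t => RInt (u z) t0 t)) (fun z t => RInt (pd1 u z) t0 t) /\
  eq_on D T (pd2 (fun z t => RInt (u z) t0 t)) (fun z t => RInt (pd2 u z) t0 t).
Proof.
  intros HD HT Ht0 [Xu [Cu [C1 [C2 _]]]].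
  split; intros z t Hz Ht; apply is_derive_unique.
  - apply (is_derive_under_RInt T (fun x s => u (x, crd2 z, crd3 z) s)); auto.
    + apply (filter_imp _ _) with (2 := open_line1 D z HD Hz). intros x Hx s Hs.
      split; [exact (proj1 (Xu _ s Hx Hs))|now apply (cont_on_time D T u)].
    + intros s Hs. now apply (cont_on_line1 D T (pd1 u)).
  - apply (is_derive_under_RInt T (fun x s => u (crd1 z, x, crd3 z) s)); auto.
    + apply (filter_imp _ _) with (2 := open_line2 D z HD Hz). intros x Hx s Hs.
      split; [exact (proj1 (proj2 (Xu _ s Hx Hs)))|now apply (cont_on_time D T u)].
    + intros s Hs. now apply (cont_on_line2 D T (pd2 u)).
Qed.

(** * Connected domains *)

(** Moving parallel to the axes inside a box shows that [w] is locally constant;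
    then the set where [w] takes a given value and its complement are both open. *)
Lemma constant_on_domain (D : vec -> Prop) (w : vec -> R) :
  is_domain D ->
  (forall z, D z ->
     is_derive (fun x => w (x, crd2 z, crd3 z)) (crd1 z) 0 /\
     is_derive (fun x => w (crd1 z, x, crd3 z)) (crd2 z) 0 /\
     is_derive (fun x => w (crd1 z, crd2 z, x)) (crd3 z) 0) ->
  forall z p, D z -> D p -> w z = w p.
Proof.
  intros [HD [Hcon _]] Hw.
  assert (Hball : forall c e, is_open_interval (ball (c : R) (e : posreal))).
  { intros c e.
    assert (Hin : forall x, ball c e x <-> c - e < x < c + e).
    { intros x. change (ball c e x) with (Rabs (x - c) < e). split.
      - intros H. apply Rabs_def2 in H. lra.
      - intros H. apply Rabs_def1; lra. }
    split; [|split].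
    - apply (open_ext (fun x => c - e < x /\ x < c + e)).
      + intros x. symmetry. apply Hin.
      + apply open_and; [apply open_gt|apply open_lt].
    - intros r s x Hr Hx Hs. apply Hin in Hr. apply Hin in Hx. apply Hin. lra.
    - exists c. apply ball_center. }
  assert (Hloc : forall z, D z -> locally z (fun y => w y = w z)).
  { intros z Hz. destruct (HD z Hz) as [e He]. exists e.
    intros [[y1 y2] y3] [[Y1 Y2] Y3].
    destruct z as [[z1 z2] z3]. cbn [fst snd] in Y1, Y2, Y3.
    assert (Hbox : forall x1 x2 x3, ball z1 e x1 -> ball z2 e x2 -> ball z3 e x3 ->
                     D (x1, x2, x3)).
    { intros x1 x2 x3 B1 B2 B3. apply He. split; [split|]; assumption. }
    transitivity (w (y1, y2, z3)).
    { apply (constant_of_zero_derivative _ (fun x => w (y1, y2, x)) (Hball z3 e));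
        [|exact Y3|apply ball_center].
      intros x Bx. now apply (Hw (y1, y2, x)), Hbox. }
    transitivity (w (y1, z2, z3)).
    { apply (constant_of_zero_derivative _ (fun x => w (y1, x, z3)) (Hball z2 e));
        [|exact Y2|apply ball_center].
      intros x Bx. apply (Hw (y1, x, z3)), Hbox; [exact Y1|exact Bx|apply ball_center]. }
    apply (constant_of_zero_derivative _ (fun x => w (x, z2, z3)) (Hball z1 e));
      [|exact Y1|apply ball_center].
    intros x Bx. apply (Hw (x, z2, z3)), Hbox; [exact Bx|apply ball_center|apply ball_center]. }
  intros z p Hz Hp.
  destruct (Req_EM_T (w z) (w p)) as [E|NE]; [exact E|exfalso].
  destruct (Hcon (fun y => locally y (fun x => w x = w p))
                 (fun y => locally y (fun x => w x <> w p))) as [y [Hy [H1 H2]]].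
  - intros y Hy. now apply locally_locally.
  - intros y Hy. now apply locally_locally.
  - intros y Hy. destruct (Req_EM_T (w y) (w p)) as [Ey|Ny].
    + left. apply (filter_imp _ _) with (2 := Hloc y Hy). intros x Hx. now rewrite Hx.
    + right. apply (filter_imp _ _) with (2 := Hloc y Hy). intros x Hx. now rewrite Hx.
  - exists p. split; [exact Hp|now apply Hloc].
  - exists z. split; [exact Hz|].
    apply (filter_imp _ _) with (2 := Hloc z Hz). intros x Hx. now rewrite Hx.
  - apply locally_singleton in H1. apply locally_singleton in H2. contradiction.
Qed.

(** * The Jacobian determinant and the field h of the perturbed map *)

Lemma C1_space_crd3 (D : vec -> Prop) (T : R -> Prop) :
  C1_space D T (fun z _ => crd3 z).
Proof.
  assert (HC : forall (v : sfield) c, (forall z t, c = v z t) -> cont_on D T v).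
  { intros v c E z t _ _. apply (continuous_ext (fun _ => c));
      [intros p; apply E|apply continuous_const]. }
  split; [|split; [|split; [|split]]].
  - intros z t _ _. split; [|split]; unfold crd3; simpl;
      first [apply ex_derive_const|apply ex_derive_id].
  - intros z t _ _. apply (continuous_comp fst (fun z : vec => crd3 z));
      [apply continuous_fst|destruct z as [z12 z3]; apply continuous_snd].
  - apply (HC _ 0). intros z t. symmetry. apply (Derive_const (crd3 z)).
  - apply (HC _ 0). intros z t. symmetry. apply (Derive_const (crd3 z)).
  - apply (HC _ 1). intros z t. symmetry. apply Derive_id.
Qed.

(** Both the third component of the perturbed map and its velocity have this
    form. *)
Lemma pd_shear (D : vec -> Prop) (T : R -> Prop) (k : R -> R -> R -> R) (b : R -> R) :
  C1_space D T (lift k) -> forall z t, D z -> T t ->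
  let u := fun z t => lift k z t + b t * crd3 z in
  pd1 u z t = pd1 (lift k) z t /\ pd2 u z t = pd2 (lift k) z t /\ pd3 u z t = b t.
Proof.
  intros [Hk _] z t Hz Ht u. destruct (Hk z t Hz Ht) as [H1 [H2 _]].
  assert (HC : forall (w : R -> R) x, ex_derive w x ->
    Derive (fun y => w y + b t * crd3 z) x = Derive w x).
  { intros w x Hw.
    rewrite (Derive_plus w (fun _ => b t * crd3 z) x Hw (ex_derive_const _ _)), Derive_const.
    apply Rplus_0_r. }
  split; [|split].
  - exact (HC _ _ H1).
  - exact (HC _ _ H2).
  - apply is_derive_unique. unfold u, lift, crd1, crd2, crd3; simpl. auto_derive; [exact I|ring].
Qed.

Lemma dt_shear (D : vec -> Prop) (T : R -> Prop) (k : R -> R -> R -> R) (b : R -> R) :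
  ex_dt D T (lift k) -> (forall t, T t -> ex_derive b t) ->
  eq_on D T (dt (fun z t => lift k z t + b t * crd3 z))
    (fun z t => lift (fun x y s => Derive (k x y) s) z t + Derive b t * crd3 z).
Proof.
  intros Hk Hb z t Hz Ht. unfold dt at 1. rewrite Derive_plus.
  - now rewrite Derive_scal_l.
  - now apply Hk.
  - apply (ex_derive_ext (fun s => crd3 z * b s)); [intros s; apply Rmult_comm|].
    now apply (ex_derive_scal b), Hb.
Qed.

Lemma jacdet_pert (D : vec -> Prop) (T : R -> Prop) (phi1 phi2 f : R -> R -> R -> R)
    (a : R -> R) :
  C1_space D T (lift f) ->
  forall z t, D z -> T t ->
    jacdet (pert_map phi1 phi2 f a) z t = jacdet (base_map phi1 phi2 a) z t.
Proof.
  intros Hf z t Hz Ht.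
  destruct (pd_shear D T f a Hf z t Hz Ht) as [_ [_ H3]].
  assert (B3 : pd3 (comp3 (base_map phi1 phi2 a)) z t = a t).
  { apply is_derive_unique. unfold comp3, base_map, crd3; simpl.
    auto_derive; [exact I|ring]. }
  unfold jacdet, det3, grad; cbn [crd1 crd2 crd3 fst snd].
  change (pd3 (comp3 (pert_map phi1 phi2 f a)) z t = a t) in H3.
  assert (Z1 : pd3 (comp1 (pert_map phi1 phi2 f a)) z t = 0)
    by exact (Derive_const (comp1 (pert_map phi1 phi2 f a) z t) _).
  assert (Z2 : pd3 (comp2 (pert_map phi1 phi2 f a)) z t = 0)
    by exact (Derive_const (comp2 (pert_map phi1 phi2 f a) z t) _).
  assert (Z1' : pd3 (comp1 (base_map phi1 phi2 a)) z t = 0)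
    by exact (Derive_const (comp1 (base_map phi1 phi2 a) z t) _).
  assert (Z2' : pd3 (comp2 (base_map phi1 phi2 a)) z t = 0)
    by exact (Derive_const (comp2 (base_map phi1 phi2 a) z t) _).
  unfold crd1, crd2, crd3; cbn [fst snd].
  rewrite H3, B3, Z1, Z2, Z1', Z2'.
  change (comp1 (pert_map phi1 phi2 f a)) with (comp1 (base_map phi1 phi2 a)).
  change (comp2 (pert_map phi1 phi2 f a)) with (comp2 (base_map phi1 phi2 a)).
  ring.
Qed.

(** The first two components of the map contribute to the third component of
    the vorticity only, as neither they nor their velocities depend on [z3]. *)
Lemma vort_pert (D : vec -> Prop) (T : R -> Prop) (phi1 phi2 f : R -> R -> R -> R)
    (a : R -> R) :
  open D -> is_open_interval T -> C2_on T a -> C1_space_C2_time D T (lift f) ->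
  forall z t, D z -> T t ->
    let F := lift f in
    let w := vort (pert_map phi1 phi2 f a) in
    comp1 w z t = a t * pd2 (dt F) z t - Derive a t * pd2 F z t /\
    comp2 w z t = Derive a t * pd1 F z t - a t * pd1 (dt F) z t /\
    comp3 w z t = comp3 (vort (base_map phi1 phi2 a)) z t
      + (pd1 (dt F) z t * pd2 F z t - pd2 (dt F) z t * pd1 F z t).
Proof.
  intros HD HT Ha [Hf [Xf [Hdf _]]] z t Hz Ht F w.
  destruct (pd_shear D T f a Hf z t Hz Ht) as [P1 [P2 P3]].
  destruct (pd_shear D T (fun x y s => Derive (f x y) s) (Derive a) Hdf z t Hz Ht)
    as [Q1 [Q2 Q3]].
  assert (E := dt_shear D T f a Xf (fun t Ht => proj1 (Ha t Ht))).
  destruct (pd_ext D T _ _ HD E) as [E1 [E2 E3]].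
  specialize (E1 z t Hz Ht). specialize (E2 z t Hz Ht). specialize (E3 z t Hz Ht).
  rewrite Q1 in E1. rewrite Q2 in E2. rewrite Q3 in E3.
  set (phi := pert_map phi1 phi2 f a) in *.
  change (pd1 (comp3 phi) z t = pd1 F z t) in P1.
  change (pd2 (comp3 phi) z t = pd2 F z t) in P2.
  change (pd3 (comp3 phi) z t = a t) in P3.
  change (pd1 (dt (comp3 phi)) z t = pd1 (dt F) z t) in E1.
  change (pd2 (dt (comp3 phi)) z t = pd2 (dt F) z t) in E2.
  change (pd3 (dt (comp3 phi)) z t = Derive a t) in E3.
  assert (Z1 : pd3 (comp1 phi) z t = 0) by exact (Derive_const (comp1 phi z t) _).
  assert (Z2 : pd3 (comp2 phi) z t = 0) by exact (Derive_const (comp2 phi z t) _).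
  assert (Z3 : pd3 (dt (comp1 phi)) z t = 0).
  { exact (Derive_const (dt (comp1 phi) z t) _). }
  assert (Z4 : pd3 (dt (comp2 phi)) z t = 0).
  { exact (Derive_const (dt (comp2 phi) z t) _). }
  set (psi := base_map phi1 phi2 a).
  assert (Y1 : pd1 (comp3 psi) z t = 0) by exact (Derive_const (comp3 psi z t) _).
  assert (Y2 : pd2 (comp3 psi) z t = 0) by exact (Derive_const (comp3 psi z t) _).
  split; [|split].
  - change (comp1 w z t) with
      ((pd2 (dt (comp1 phi)) z t * pd3 (comp1 phi) z t
        - pd3 (dt (comp1 phi)) z t * pd2 (comp1 phi) z t)
       + (pd2 (dt (comp2 phi)) z t * pd3 (comp2 phi) z t
        - pd3 (dt (comp2 phi)) z t * pd2 (comp2 phi) z t)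
       + (pd2 (dt (comp3 phi)) z t * pd3 (comp3 phi) z t
        - pd3 (dt (comp3 phi)) z t * pd2 (comp3 phi) z t)).
    rewrite Z1, Z2, Z3, Z4, E2, E3, P2, P3. ring.
  - change (comp2 w z t) with
      ((pd3 (dt (comp1 phi)) z t * pd1 (comp1 phi) z t
        - pd1 (dt (comp1 phi)) z t * pd3 (comp1 phi) z t)
       + (pd3 (dt (comp2 phi)) z t * pd1 (comp2 phi) z t
        - pd1 (dt (comp2 phi)) z t * pd3 (comp2 phi) z t)
       + (pd3 (dt (comp3 phi)) z t * pd1 (comp3 phi) z t
        - pd1 (dt (comp3 phi)) z t * pd3 (comp3 phi) z t)).
    rewrite Z1, Z2, Z3, Z4, E1, E3, P1, P3. ring.
  - assert (V : forall chi : vfield, comp3 (vort chi) z t =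
      (pd1 (dt (comp1 chi)) z t * pd2 (comp1 chi) z t
        - pd2 (dt (comp1 chi)) z t * pd1 (comp1 chi) z t)
       + (pd1 (dt (comp2 chi)) z t * pd2 (comp2 chi) z t
        - pd2 (dt (comp2 chi)) z t * pd1 (comp2 chi) z t)
       + (pd1 (dt (comp3 chi)) z t * pd2 (comp3 chi) z t
        - pd2 (dt (comp3 chi)) z t * pd1 (comp3 chi) z t)) by reflexivity.
    unfold w. rewrite (V phi), (V psi).
    change (comp1 phi) with (comp1 psi). change (comp2 phi) with (comp2 psi).
    rewrite E1, E2, P1, P2, Y1, Y2. ring.
Qed.

Lemma hvec_lin_density (t0 c0 : R) (phi : vfield) (z : vec) (t : R) :
  let I := fun z t => RInt (comp3 phi z) t0 t in
  let h := hvec t0 phi (lin_density c0) in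
  comp1 h z t = comp1 (vort phi) z t - c0 * pd2 I z t /\
  comp2 h z t = comp2 (vort phi) z t + c0 * pd1 I z t /\
  comp3 h z t = comp3 (vort phi) z t.
Proof.
  intros I h.
  assert (R1 : pd1 (lin_density c0) z t = 0) by exact (Derive_const (lin_density c0 z t) _).
  assert (R2 : pd2 (lin_density c0) z t = 0) by exact (Derive_const (lin_density c0 z t) _).
  assert (R3 : pd3 (lin_density c0) z t = c0).
  { apply is_derive_unique. unfold lin_density, crd3; simpl. auto_derive; [exact Logic.I|ring]. }
  split; [|split].
  - change (comp1 h z t) with (comp1 (vort phi) z t
      + (pd2 (lin_density c0) z t * pd3 I z t - pd3 (lin_density c0) z t * pd2 I z t)).
    rewrite R2, R3. ring.
  - change (comp2 h z t) with (comp2 (vort phi) z t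
      + (pd3 (lin_density c0) z t * pd1 I z t - pd1 (lin_density c0) z t * pd3 I z t)).
    rewrite R1, R3. ring.
  - change (comp3 h z t) with (comp3 (vort phi) z t
      + (pd1 (lin_density c0) z t * pd2 I z t - pd2 (lin_density c0) z t * pd1 I z t)).
    rewrite R1, R2. ring.
Qed.

Lemma C1_space_C2_time_pert3 (D : vec -> Prop) (T : R -> Prop)
    (phi1 phi2 f : R -> R -> R -> R) (a : R -> R) :
  open D -> is_open_interval T -> C2_on T a -> C1_space_C2_time D T (lift f) ->
  C1_space_C2_time D T (comp3 (pert_map phi1 phi2 f a)).
Proof.
  intros HD HT Ha Hf.
  apply (C1_space_C2_time_plus D T (lift f) (fun z t => a t * crd3 z)); auto.
  apply C1_space_C2_time_scal; auto. apply C1_space_crd3.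
Qed.

Lemma hvec_pert (D : vec -> Prop) (T : R -> Prop) (t0 : R)
    (phi1 phi2 f : R -> R -> R -> R) (a : R -> R) (c0 : R) :
  open D -> is_open_interval T -> T t0 -> C2_on T a -> C1_space_C2_time D T (lift f) ->
  forall z t, D z -> T t ->
    let F := lift f in
    let h := hvec t0 (pert_map phi1 phi2 f a) (lin_density c0) in
    comp1 h z t = a t * pd2 (dt F) z t - Derive a t * pd2 F z t
                  - c0 * RInt (pd2 F z) t0 t /\
    comp2 h z t = - (a t * pd1 (dt F) z t - Derive a t * pd1 F z t
                     - c0 * RInt (pd1 F z) t0 t).
Proof.
  intros HD HT Ht0 Ha Hf z t Hz Ht F h.
  destruct (hvec_lin_density t0 c0 (pert_map phi1 phi2 f a) z t) as [H1 [H2 _]].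
  destruct (vort_pert D T phi1 phi2 f a HD HT Ha Hf z t Hz Ht) as [V1 [V2 _]].
  assert (HG := proj1 (C1_space_C2_time_pert3 D T phi1 phi2 f a HD HT Ha Hf)).
  destruct (pd_RInt D T _ t0 HD HT Ht0 HG) as [I1 I2].
  specialize (I1 z t Hz Ht). specialize (I2 z t Hz Ht). cbv beta in I1, I2.
  assert (P : forall s, Rmin t0 t < s < Rmax t0 t ->
    pd1 (comp3 (pert_map phi1 phi2 f a)) z s = pd1 F z s /\
    pd2 (comp3 (pert_map phi1 phi2 f a)) z s = pd2 F z s).
  { intros s Hs.
    destruct (pd_shear D T f a (proj1 Hf) z s Hz) as [P1 [P2 _]].
    - apply (interval_between T t0 t); auto. lra.
    - now split. }
  rewrite (RInt_ext _ (pd1 F z)) in I1 by (intros s Hs; now apply P).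
  rewrite (RInt_ext _ (pd2 F z)) in I2 by (intros s Hs; now apply P).
  unfold h. rewrite H1, H2, V1, V2. fold F.
  split.
  - now rewrite I2.
  - rewrite I1. ring.
Qed.

(** The two terms [a' g'] cancel. *)
Lemma is_derive_shear_vorticity (T : R -> Prop) (t0 c0 : R) (a g g1 : R -> R) (g2 t : R) :
  is_open_interval T -> T t0 -> T t -> C2_on T a ->
  (forall s, T s -> is_derive g s (g1 s)) -> is_derive g1 t g2 ->
  is_derive (fun s => a s * g1 s - Derive a s * g s - c0 * RInt g t0 s) t
    (a t * g2 - Derive (Derive a) t * g t - c0 * g t).
Proof.
  intros HT Ht0 Ht Ha Hg Hg1. destruct (Ha t Ht) as [A1 [A2 _]].
  eapply is_derive_value.
  - apply (is_derive_minus (K := R_AbsRing) (V := R_NormedModule)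
             (fun s => a s * g1 s - Derive a s * g s)).
    + apply (is_derive_minus (K := R_AbsRing) (V := R_NormedModule) (fun s => a s * g1 s)).
      * apply (is_derive_mult (K := R_AbsRing) a g1);
          [now apply Derive_correct|exact Hg1|intros; apply Rmult_comm].
      * apply (is_derive_mult (K := R_AbsRing) (Derive a) g);
          [now apply Derive_correct|now apply Hg|intros; apply Rmult_comm].
    + apply (is_derive_scal (fun s => RInt g t0 s)).
      apply (is_derive_RInt_interval T g t0 t HT); auto.
      intros s Hs. exact (is_derive_continuous _ _ _ (Hg s Hs)).
  - unfold minus, plus, opp, mult; simpl. ring.
Qed.

Lemma hvec_pert_derivatives (D : vec -> Prop) (T : R -> Prop) (t0 : R)
    (phi1 phi2 f : R -> R -> R -> R) (a : R -> R) (c0 : R) :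
  open D -> is_open_interval T -> T t0 -> C2_on T a -> C1_space_C2_time D T (lift f) ->
  forall z t, D z -> T t ->
    let F := lift f in
    let h := hvec t0 (pert_map phi1 phi2 f a) (lin_density c0) in
    is_derive (comp1 h z) t
      (a t * pd2 (dt (dt F)) z t - Derive (Derive a) t * pd2 F z t - c0 * pd2 F z t) /\
    is_derive (fun s => - comp2 h z s) t
      (a t * pd1 (dt (dt F)) z t - Derive (Derive a) t * pd1 F z t - c0 * pd1 F z t).
Proof.
  intros HD HT Ht0 Ha Hf z t Hz Ht F h.
  assert (Hh := hvec_pert D T t0 phi1 phi2 f a c0 HD HT Ht0 Ha Hf z).
  destruct Hf as [F0 [X0 [F1 [X1 F2]]]].
  assert (C0 := pd_dt_commute D T F HD HT F0 X0 F1 z).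
  assert (C1 := pd_dt_commute D T (dt F) HD HT F1 X1 F2 z).
  split.
  - apply (is_derive_ext_loc (fun s => a s * pd2 (dt F) z s - Derive a s * pd2 F z s
                                       - c0 * RInt (pd2 F z) t0 s)).
    + apply (filter_imp T); [|now apply interval_locally]. intros s Hs.
      symmetry. exact (proj1 (Hh s Hz Hs)).
    + apply (is_derive_shear_vorticity T); auto.
      * intros s Hs. exact (proj2 (C0 s Hz Hs)).
      * exact (proj2 (C1 t Hz Ht)).
  - apply (is_derive_ext_loc (fun s => a s * pd1 (dt F) z s - Derive a s * pd1 F z s
                                       - c0 * RInt (pd1 F z) t0 s)).
    + apply (filter_imp T); [|now apply interval_locally]. intros s Hs.
      unfold h. rewrite (proj2 (Hh s Hz Hs)). symmetry. apply Ropp_involutive.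
    + apply (is_derive_shear_vorticity T); auto.
      * intros s Hs. exact (proj1 (C0 s Hz Hs)).
      * exact (proj1 (C1 t Hz Ht)).
Qed.

(** * The residual *)

Lemma h12_constant_iff_gradient (D : vec -> Prop) (T : R -> Prop) (t0 : R)
    (phi1 phi2 f : R -> R -> R -> R) (a : R -> R) (c0 : R) :
  open D -> is_open_interval T -> T t0 -> C2_on T a -> C1_space_C2_time D T (lift f) ->
  let F := lift f in
  h12_constant D T (hvec t0 (pert_map phi1 phi2 f a) (lin_density c0)) <->
  forall z t, D z -> T t ->
    a t * pd1 (dt (dt F)) z t - (Derive (Derive a) t + c0) * pd1 F z t = 0 /\
    a t * pd2 (dt (dt F)) z t - (Derive (Derive a) t + c0) * pd2 F z t = 0.
Proof.
  intros HD HT Ht0 Ha Hf F.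
  assert (Hh := hvec_pert_derivatives D T t0 phi1 phi2 f a c0 HD HT Ht0 Ha Hf).
  split.
  - intros H z t Hz Ht. destruct (H z t Hz Ht) as [K1 K2].
    destruct (Hh z t Hz Ht) as [H1 H2].
    apply (is_derive_opp (K := R_AbsRing) (V := R_NormedModule)) in K2.
    assert (U : forall (g : R -> R) l m, is_derive g t l -> is_derive g t m -> l = m).
    { intros g l m L M. rewrite <- (is_derive_unique _ _ _ L). now apply is_derive_unique. }
    apply (U _ _ _ H1) in K1. apply (U _ _ _ H2) in K2.
    unfold opp in K2; simpl in K2. unfold F. split; lra.
  - intros H z t Hz Ht. destruct (H z t Hz Ht) as [K1 K2].
    destruct (Hh z t Hz Ht) as [H1 H2]. fold F in H1, H2. split.
    + apply (is_derive_value _ _ _ _ H1). lra.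
    + apply (is_derive_opp (K := R_AbsRing) (V := R_NormedModule)) in H2.
      apply (is_derive_ext
        (fun s => - - comp2 (hvec t0 (pert_map phi1 phi2 f a) (lin_density c0)) z s));
        [intros s; apply Ropp_involutive|].
      apply (is_derive_value _ _ _ _ H2). unfold opp; simpl. lra.
Qed.

Lemma is_derive_residual (D : vec -> Prop) (T : R -> Prop) (f : R -> R -> R -> R)
    (a : R -> R) (c0 : R) :
  C1_space_C2_time D T (lift f) ->
  forall z t, D z -> T t ->
    let F := lift f in
    is_derive (fun x => residual a c0 f (x, crd2 z, crd3 z) t) (crd1 z)
      (a t * pd1 (dt (dt F)) z t - (Derive (Derive a) t + c0) * pd1 F z t) /\
    is_derive (fun x => residual a c0 f (crd1 z, x, crd3 z) t) (crd2 z)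
      (a t * pd2 (dt (dt F)) z t - (Derive (Derive a) t + c0) * pd2 F z t) /\
    is_derive (fun x => residual a c0 f (crd1 z, crd2 z, x) t) (crd3 z) 0.
Proof.
  intros [[H0 _] [_ [_ [_ [H2 _]]]]] z t Hz Ht F.
  split; [|split].
  - apply (is_derive_minus (K := R_AbsRing) (V := R_NormedModule)
             (fun x => a t * dt (dt F) (x, crd2 z, crd3 z) t)).
    + apply (is_derive_scal (fun x => dt (dt F) (x, crd2 z, crd3 z) t)).
      apply Derive_correct. exact (proj1 (H2 z t Hz Ht)).
    + apply (is_derive_scal (fun x => F (x, crd2 z, crd3 z) t)).
      apply Derive_correct. exact (proj1 (H0 z t Hz Ht)).
  - apply (is_derive_minus (K := R_AbsRing) (V := R_NormedModule)
             (fun x => a t * dt (dt F) (crd1 z, x, crd3 z) t)).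
    + apply (is_derive_scal (fun x => dt (dt F) (crd1 z, x, crd3 z) t)).
      apply Derive_correct. exact (proj1 (proj2 (H2 z t Hz Ht))).
    + apply (is_derive_scal (fun x => F (crd1 z, x, crd3 z) t)).
      apply Derive_correct. exact (proj1 (proj2 (H0 z t Hz Ht))).
  - apply (is_derive_const (K := R_AbsRing) (V := R_NormedModule)
             (residual a c0 f z t)).
Qed.

(** The time derivatives of the horizontal components of [h] form the gradient
    of the residual. *)
Lemma h12_constant_iff_residual (D : vec -> Prop) (T : R -> Prop) (t0 : R)
    (phi1 phi2 f : R -> R -> R -> R) (a : R -> R) (c0 : R) :
  is_domain D -> is_open_interval T -> T t0 -> C2_on T a ->
  C1_space_C2_time D T (lift f) ->
  h12_constant D T (hvec t0 (pert_map phi1 phi2 f a) (lin_density c0)) <->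
  forall z p t, D z -> D p -> T t -> residual a c0 f z t = residual a c0 f p t.
Proof.
  intros HD HT Ht0 Ha Hf. assert (HDo := proj1 HD).
  assert (Hr := is_derive_residual D T f a c0 Hf).
  assert (Hiff := h12_constant_iff_gradient D T t0 phi1 phi2 f a c0 HDo HT Ht0 Ha Hf).
  split.
  - intros H z p t Hz Hp Ht.
    apply (constant_on_domain D (fun y => residual a c0 f y t) HD); auto.
    intros y Hy. destruct (proj1 Hiff H y t Hy Ht) as [G1 G2].
    destruct (Hr y t Hy Ht) as [R1 [R2 R3]].
    rewrite G1 in R1. rewrite G2 in R2. auto.
  - intros H. apply Hiff. intros z t Hz Ht.
    destruct (Hr z t Hz Ht) as [R1 [R2 _]].
    split.
    + rewrite <- (is_derive_unique _ _ _ R1).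
      rewrite (Derive_ext_loc _ (fun _ => residual a c0 f z t)); [apply Derive_const|].
      apply (filter_imp _ _) with (2 := open_line1 D z HDo Hz). intros x Hx. now apply H.
    + rewrite <- (is_derive_unique _ _ _ R2).
      rewrite (Derive_ext_loc _ (fun _ => residual a c0 f z t)); [apply Derive_const|].
      apply (filter_imp _ _) with (2 := open_line2 D z HDo Hz). intros x Hx. now apply H.
Qed.

Lemma residual_minus_time (D : vec -> Prop) (T : R -> Prop) (f : R -> R -> R -> R)
    (a b : R -> R) (c0 : R) :
  is_open_interval T -> C1_space_C2_time D T (lift f) -> C2_on T b ->
  forall z t, D z -> T t ->
    residual a c0 (fun x y t => f x y t - b t) z t
    = residual a c0 f z t
      - (a t * Derive (Derive b) t - (Derive (Derive a) t + c0) * b t).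
Proof.
  intros HT [_ [X0 [_ [X1 _]]]] Hb z t Hz Ht.
  assert (E : eq_on D T (dt (lift (fun x y t => f x y t - b t)))
                        (fun z t => dt (lift f) z t - Derive b t)).
  { intros y s Hy Hs. exact (Derive_minus _ _ _ (X0 y s Hy Hs) (proj1 (Hb s Hs))). }
  unfold residual. rewrite (dt_ext D T _ _ HT E z t Hz Ht).
  replace (dt (fun z t => dt (lift f) z t - Derive b t) z t)
    with (dt (dt (lift f)) z t - Derive (Derive b) t).
  - change (lift (fun x y t => f x y t - b t) z t) with (lift f z t - b t). ring.
  - symmetry. exact (Derive_minus _ _ _ (X1 z t Hz Ht) (proj1 (proj2 (Hb t Ht)))).
Qed.

Lemma C2_on_at_point (D : vec -> Prop) (T : R -> Prop) (u : sfield) (p : vec) :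
  C1_space_C2_time D T u -> D p -> C2_on T (u p).
Proof.
  intros [_ [X0 [_ [X1 [_ [C2 _]]]]]] Hp t Ht.
  split; [now apply X0|split; [now apply X1|]].
  now apply (cont_on_time D T (dt (dt u))).
Qed.

(** * The general solution *)

Lemma continuous_qfun (T : R -> Prop) (a : R -> R) (c0 : R) :
  C2_on T a -> (forall t, T t -> a t <> 0) -> forall t, T t -> continuous (qfun a c0) t.
Proof.
  intros Ha Ha0 t Ht. apply continuous_Ropp, continuous_Rmult.
  - apply (continuous_plus (K := R_AbsRing) (V := R_NormedModule));
      [now apply Ha|apply continuous_const].
  - apply continuous_Rinv_comp; [now apply (C2_on_continuous T)|now apply Ha0].
Qed.

Lemma residual_qfun (a : R -> R) (c0 : R) (g : R -> R -> R -> R) (z : vec) (t : R) :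
  a t <> 0 ->
  residual a c0 g z t
  = a t * (dt (dt (lift g)) z t + qfun a c0 t * lift g z t).
Proof. intros Ha. unfold residual, qfun. field. exact Ha. Qed.

(** Division by [a] turns the equation into its normal form along each
    trajectory. *)
Lemma f_equation_iff_ode (D : vec -> Prop) (T : R -> Prop) (a : R -> R) (c0 : R)
    (g : R -> R -> R -> R) :
  (forall t, T t -> a t <> 0) -> C1_space_C2_time D T (lift g) ->
  f_equation D T a c0 g <-> forall z, D z -> ode_solution T (qfun a c0) (lift g z).
Proof.
  intros Ha0 [_ [X0 [_ [X1 _]]]]. split.
  - intros H z Hz t Ht. split; [now apply X0|split; [now apply X1|]].
    specialize (H z t Hz Ht). rewrite residual_qfun in H by now apply Ha0.
    apply Rmult_integral in H as [H|H]; [now apply Ha0 in H|exact H].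
  - intros H z t Hz Ht. rewrite residual_qfun by now apply Ha0.
    destruct (H z Hz t Ht) as [_ [_ E]].
    change (Derive (Derive (lift g z)) t) with (dt (dt (lift g)) z t) in E.
    rewrite E. apply Rmult_0_r.
Qed.

(** The coefficients are the Cramer quotients at [t0], linear combinations of
    [g] and its time derivative at that fixed time, hence as regular in space as
    these fields. *)
Lemma general_solution (D : vec -> Prop) (T : R -> Prop) (t0 : R) (a : R -> R) (c0 : R)
    (a1 a2 : R -> R) (g : R -> R -> R -> R) :
  open D -> is_open_interval T -> T t0 -> C2_on T a -> (forall t, T t -> a t <> 0) ->
  ode_solution T (qfun a c0) a1 -> ode_solution T (qfun a c0) a2 -> lin_indep T a1 a2 ->
  (C1_space_C2_time D T (lift g) /\ f_equation D T a c0 g) <->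
  exists f1 f2 : R -> R -> R,
    C1_space D T (lift_static f1) /\ C1_space D T (lift_static f2) /\
    forall z t, D z -> T t ->
      lift g z t = a1 t * lift_static f1 z t + a2 t * lift_static f2 z t.
Proof.
  intros HD HT Ht0 Ha Ha0 H1 H2 Hind.
  set (q := qfun a c0) in *.
  assert (Hq := continuous_qfun T a c0 Ha Ha0 : forall t, T t -> continuous q t).
  split.
  - intros [Hg Heq].
    assert (Hode := proj1 (f_equation_iff_ode D T a c0 g Ha0 Hg) Heq). fold q in Hode.
    assert (HW := wronskian_lin_indep T q a1 a2 t0 HT Ht0 Hq H1 H2 Hind).
    set (W := wronskian a1 a2 t0) in *.
    assert (HC : forall (w : sfield) k m,
      (forall z t, k * lift g z t0 + m * dt (lift g) z t0 = w z t) -> C1_space D T w).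
    { intros w k m E.
      apply (C1_space_ext D T (fun z t => k * lift g z t0 + m * dt (lift g) z t0)); auto.
      { intros z t _ _. apply E. }
      destruct Hg as [G0 [_ [G1 _]]].
      apply C1_space_plus; [exact HD|apply HT| |];
        apply (C1_space_scal D T (fun _ => _) (fun z _ => _ z t0));
        try (intros; apply continuous_const);
        now apply (C1_space_fixed_time D T). }
    exists (fun x y => wronskian (g x y) a2 t0 / W), (fun x y => wronskian a1 (g x y) t0 / W).
    split; [|split].
    + apply (HC _ (Derive a2 t0 / W) (- a2 t0 / W)). intros z t.
      change (dt (lift g) z t0) with (Derive (g (crd1 z) (crd2 z)) t0).
      unfold lift_static, wronskian, lift. field. exact HW.
    + apply (HC _ (- Derive a1 t0 / W) (a1 t0 / W)). intros z t.
      change (dt (lift g) z t0) with (Derive (g (crd1 z) (crd2 z)) t0).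
      unfold lift_static, wronskian, lift. field. exact HW.
    + intros z t Hz Ht. now apply (ode_expansion T q a1 a2 (lift g z) t0 t); auto.
  - intros [f1 [f2 [C1 [C2 E]]]].
    assert (Hg : C1_space_C2_time D T (lift g)).
    { apply (C1_space_C2_time_ext D T
        (fun z t => a1 t * lift_static f1 z 0 + a2 t * lift_static f2 z 0)); auto.
      - intros z t Hz Ht. symmetry. exact (E z t Hz Ht).
      - apply C1_space_C2_time_plus; auto;
          apply (C1_space_C2_time_scal D T _ (fun z => lift_static _ z 0)); auto;
          now apply (ode_solution_C2 T q). }
    split; [exact Hg|].
    apply f_equation_iff_ode; auto. fold q. intros z Hz.
    apply (ode_solution_combination T q a1 a2 _ (f1 (crd1 z) (crd2 z)) (f2 (crd1 z) (crd2 z)));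
      auto.
Qed.

(** * Solutions of the Euler-Boussinesq equations *)

(** Both horizontal derivatives of [f] solve the same linear equation in time,
    and this expression is their Wronskian up to sign. *)
Lemma gradient_wronskian_time_indep (D : vec -> Prop) (T : R -> Prop) (f : R -> R -> R -> R)
    (a : R -> R) (c0 : R) :
  open D -> is_open_interval T -> (forall t, T t -> a t <> 0) ->
  C1_space_C2_time D T (lift f) ->
  let F := lift f in
  (forall z t, D z -> T t ->
    a t * pd1 (dt (dt F)) z t - (Derive (Derive a) t + c0) * pd1 F z t = 0 /\
    a t * pd2 (dt (dt F)) z t - (Derive (Derive a) t + c0) * pd2 F z t = 0) ->
  time_indep D T
    (fun z t => pd1 (dt F) z t * pd2 F z t - pd2 (dt F) z t * pd1 F z t).
Proof.
  intros HD HT Ha0 [F0 [X0 [F1 [X1 F2]]]] F H z s t Hz Hs Ht.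
  apply (constant_of_zero_derivative T
    (fun t => pd1 (dt F) z t * pd2 F z t - pd2 (dt F) z t * pd1 F z t)); auto.
  clear s t Hs Ht. intros t Ht.
  destruct (pd_dt_commute D T F HD HT F0 X0 F1 z t Hz Ht) as [C1 C2].
  destruct (pd_dt_commute D T (dt F) HD HT F1 X1 F2 z t Hz Ht) as [C3 C4].
  destruct (H z t Hz Ht) as [G1 G2].
  eapply is_derive_value.
  - apply (is_derive_minus (K := R_AbsRing) (V := R_NormedModule)
             (fun t => pd1 (dt F) z t * pd2 F z t)).
    + apply (is_derive_mult (K := R_AbsRing) (pd1 (dt F) z) (pd2 F z));
        eauto. intros; apply Rmult_comm.
    + apply (is_derive_mult (K := R_AbsRing) (pd2 (dt F) z) (pd1 F z));
        eauto. intros; apply Rmult_comm.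
  - unfold minus, plus, opp, mult; simpl.
    apply (Rmult_eq_reg_l (a t)); [|now apply Ha0].
    transitivity ((a t * pd1 (dt (dt F)) z t) * pd2 F z t
                  - (a t * pd2 (dt (dt F)) z t) * pd1 F z t); [ring|].
    replace (a t * pd1 (dt (dt F)) z t)
      with ((Derive (Derive a) t + c0) * pd1 F z t) by lra.
    replace (a t * pd2 (dt (dt F)) z t)
      with ((Derive (Derive a) t + c0) * pd2 F z t) by lra.
    ring.
Qed.

(** The third component of [h] differs from that of the unperturbed map, which
    is constant by the Euler equations, by a Wronskian that is constant as well. *)
Lemma h12_constant_iff_solution (D : vec -> Prop) (T : R -> Prop) (t0 : R)
    (phi1 phi2 f : R -> R -> R -> R) (a : R -> R) (c0 : R) :
  open D -> is_open_interval T -> T t0 -> C2_on T a -> (forall t, T t -> a t <> 0) ->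
  euler_solution D T (base_map phi1 phi2 a) -> C1_space_C2_time D T (lift f) ->
  h12_constant D T (hvec t0 (pert_map phi1 phi2 f a) (lin_density c0)) <->
  euler_boussinesq_solution D T t0 (pert_map phi1 phi2 f a) (lin_density c0).
Proof.
  intros HD HT Ht0 Ha Ha0 [Hreg [Hdet [Hdet' Hvort]]] Hf.
  set (phi := pert_map phi1 phi2 f a). set (h := hvec t0 phi (lin_density c0)).
  assert (HJ := jacdet_pert D T phi1 phi2 f a (proj1 Hf)).
  split.
  - intros H.
    assert (HW := gradient_wronskian_time_indep D T f a c0 HD HT Ha0 Hf
      (proj1 (h12_constant_iff_gradient D T t0 phi1 phi2 f a c0 HD HT Ht0 Ha Hf) H)).
    split; [|split; [|split; [|split; [|split]]]].
    + split; [apply Hreg|split; [apply Hreg|]]. now apply C1_space_C2_time_pert3.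
    + apply (C1_space_scal D T (fun _ => c0) (fun z _ => crd3 z)).
      * intros; apply continuous_const.
      * apply C1_space_crd3.
    + intros z t Hz Ht. unfold phi. rewrite HJ by assumption. now apply Hdet.
    + intros z s t Hz Hs Ht. unfold phi. rewrite !HJ by assumption. now apply Hdet'.
    + intros z s t _ _ _. reflexivity.
    + intros z s t Hz Hs Ht.
      assert (K1 : comp1 h z s = comp1 h z t).
      { apply (constant_of_zero_derivative T (comp1 h z)); auto.
        intros r Hr. now apply (H z r). }
      assert (K2 : comp2 h z s = comp2 h z t).
      { apply (constant_of_zero_derivative T (comp2 h z)); auto.
        intros r Hr. now apply (H z r). }
      assert (K3 : comp3 h z s = comp3 h z t).
      { assert (B := Hvort z s t Hz Hs Ht).
        apply (f_equal crd3) in B.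
        change (comp3 (vort (base_map phi1 phi2 a)) z s
                = comp3 (vort (base_map phi1 phi2 a)) z t) in B.
        unfold h. rewrite !(proj2 (proj2 (hvec_lin_density t0 c0 phi z _))).
        unfold phi.
        rewrite (proj2 (proj2 (vort_pert D T phi1 phi2 f a HD HT Ha Hf z s Hz Hs))).
        rewrite (proj2 (proj2 (vort_pert D T phi1 phi2 f a HD HT Ha Hf z t Hz Ht))).
        specialize (HW z s t Hz Hs Ht). cbv beta in HW. rewrite HW.
        now rewrite B. }
      fold h. unfold comp1, comp2, comp3, crd1, crd2, crd3 in K1, K2, K3.
      destruct (h z s) as [[x1 x2] x3]. destruct (h z t) as [[y1 y2] y3].
      simpl in K1, K2, K3. now subst.
  - intros [_ [_ [_ [_ [_ Hh]]]]] z t Hz Ht.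
    assert (K : forall c : vec -> R, is_derive (fun s => c (h z s)) t 0).
    { intros c. apply (is_derive_ext_loc (fun _ => c (h z t))).
      - apply (filter_imp T); [|now apply interval_locally]. intros s Hs.
        now rewrite (Hh z t s Hz Ht Hs : h z t = h z s).
      - apply (is_derive_const (K := R_AbsRing) (V := R_NormedModule)). }
    split; apply K.
Qed.

Theorem mainTheorem5
  (D : vec -> Prop) (T : R -> Prop) (t0 : R)
  (phi1 phi2 f : R -> R -> R -> R) (a : R -> R) (c0 : R)
  (HD : is_domain D) (HT : is_open_interval T) (Ht0 : T t0)
  (Ha : C2_on T a) (Ha0 : forall t, T t -> a t <> 0)
  (Heuler : euler_solution D T (base_map phi1 phi2 a))
  (Hf : C1_space_C2_time D T (lift f)) :
  let phi := pert_map phi1 phi2 f a in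
  let rho := lin_density c0 in
  let h := hvec t0 phi rho in
  let h_base := hvec t0 (base_map phi1 phi2 a) rho in
  let F := lift f in
  (* f does not affect the Jacobian determinant *)
  (forall z t, D z -> T t ->
     jacdet phi z t = jacdet (base_map phi1 phi2 a) z t) /\
  (* the contribution of f to h^3; it is independent of time once (h^1)' and
     (h^2)' vanish *)
  (forall z t, D z -> T t ->
     comp3 h z t = comp3 h_base z t
       + (pd1 (dt F) z t * pd2 F z t - pd2 (dt F) z t * pd1 F z t)) /\
  (h12_constant D T h ->
     time_indep D T (fun z t => comp3 h z t - comp3 h_base z t)) /\
  (* (h^1)' and -(h^2)' *)
  (forall z t, D z -> T t ->
     is_derive (comp1 h z) t
       (a t * pd2 (dt (dt F)) z t - Derive (Derive a) t * pd2 F z t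
        - c0 * pd2 F z t)) /\
  (forall z t, D z -> T t ->
     is_derive (fun s => - comp2 h z s) t
       (a t * pd1 (dt (dt F)) z t - Derive (Derive a) t * pd1 F z t
        - c0 * pd1 F z t)) /\
  (* (h^1)' = (h^2)' = 0 iff Euler-Boussinesq, and iff a f'' - (a''+c0) f = 0,
     up to adding to f a function of time alone *)
  (h12_constant D T h <-> euler_boussinesq_solution D T t0 phi rho) /\
  (h12_constant D T h <->
     exists b : R -> R, C2_on T b /\
       f_equation D T a c0 (fun x y t => f x y t - b t)) /\
  (forall p, D p -> (forall t, T t -> residual a c0 f p t = 0) ->
     (h12_constant D T h <-> f_equation D T a c0 f)) /\
  (* the general solution of a f'' - (a''+c0) f = 0 *)
  (exists a1 a2 : R -> R,
     ode_solution T (qfun a c0) a1 /\ ode_solution T (qfun a c0) a2 /\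
     lin_indep T a1 a2) /\
  (forall a1 a2 : R -> R,
     ode_solution T (qfun a c0) a1 -> ode_solution T (qfun a c0) a2 ->
     lin_indep T a1 a2 ->
     forall g : R -> R -> R -> R,
       (C1_space_C2_time D T (lift g) /\ f_equation D T a c0 g) <->
       exists f1 f2 : R -> R -> R,
         C1_space D T (lift_static f1) /\ C1_space D T (lift_static f2) /\
         forall z t, D z -> T t ->
           lift g z t = a1 t * lift_static f1 z t + a2 t * lift_static f2 z t).
Proof.
  intros phi rho h h_base F. assert (HDo := proj1 HD).
  assert (H3 : forall z t, D z -> T t ->
     comp3 h z t = comp3 h_base z t
       + (pd1 (dt F) z t * pd2 F z t - pd2 (dt F) z t * pd1 F z t)).
  { intros z t Hz Ht. unfold h, h_base, rho.
    rewrite !(proj2 (proj2 (hvec_lin_density _ _ _ _ _))).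
    now apply (vort_pert D T). }
  assert (Hgrad := h12_constant_iff_gradient D T t0 phi1 phi2 f a c0 HDo HT Ht0 Ha Hf).
  assert (Hres := h12_constant_iff_residual D T t0 phi1 phi2 f a c0 HD HT Ht0 Ha Hf).
  assert (Hder := hvec_pert_derivatives D T t0 phi1 phi2 f a c0 HDo HT Ht0 Ha Hf).
  split; [exact (jacdet_pert D T phi1 phi2 f a (proj1 Hf))|].
  split; [exact H3|].
  split.
  { intros H z s t Hz Hs Ht. rewrite !H3 by assumption.
    assert (HW := gradient_wronskian_time_indep D T f a c0 HDo HT Ha0 Hf
      (proj1 Hgrad H) z s t Hz Hs Ht).
    cbv beta in HW. unfold F. rewrite HW. ring. }
  split; [intros z t Hz Ht; exact (proj1 (Hder z t Hz Ht))|].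
  split; [intros z t Hz Ht; exact (proj2 (Hder z t Hz Ht))|].
  split; [now apply h12_constant_iff_solution|].
  split.
  { split.
    (* b is the value of f along the trajectory of a base point. *)
    - intros H. destruct HD as [_ [_ [p Hp]]]. exists (F p).
      assert (Hb := C2_on_at_point D T F p Hf Hp). split; [exact Hb|].
      intros z t Hz Ht.
      rewrite (residual_minus_time D T f a (F p) c0 HT Hf Hb z t Hz Ht).
      rewrite (proj1 Hres H z p t Hz Hp Ht). apply Rminus_diag_eq. reflexivity.
    - intros [b [Hb H]]. apply Hres. intros z p t Hz Hp Ht.
      assert (E1 := H z t Hz Ht). assert (E2 := H p t Hp Ht).
      rewrite (residual_minus_time D T f a b c0 HT Hf Hb) in E1, E2 by assumption. lra. }
  split.
  { intros p Hp Hp0. split.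
    - intros H z t Hz Ht. rewrite (proj1 Hres H z p t Hz Hp Ht). now apply Hp0.
    - intros H. apply Hres. intros z y t Hz Hy Ht.
      now rewrite (H z t Hz Ht), (H y t Hy Ht). }
  split.
  { destruct (ode_fundamental_pair T (qfun a c0) t0 HT Ht0 (continuous_qfun T a c0 Ha Ha0))
      as [e1 [e2 [E1 [E2 [V1 [D1 [V2 D2]]]]]]].
    exists e1, e2. split; [exact E1|split; [exact E2|]].
    apply (fundamental_pair_lin_indep T t0); auto.
    - now apply (E1 t0).
    - now apply (E2 t0).
    - unfold wronskian. rewrite V1, V2, D1, D2. lra. }
  intros a1 a2 H1 H2 Hind g. now apply (general_solution D T t0).
Qed.
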